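(* If $G$ is a polycyclic group and $\phi:G\to G$ is a monomorphism, then the ascending HNN extension $G_\phi$ is highly residually finite.
   Context: For a group monomorphism $\phi:G\to G$, the ascending HNN extension of $G$ with respect to $\phi$ is $G_{\phi}=\langle G,t\mid t^{-1}gt=\phi(g)\ \text{for all } g\in G\rangle$. For a group $\Gamma$, let $\hat{\Gamma}$ be its profinite completion and $c_\Gamma:\Gamma\to\hat{\Gamma}$ the completion map. For a nonnegative integer $n$, $\mathcal{A}_n$ is the class of all groups $\Gamma$ such that, for every finite discrete $\hat{\Gamma}$-module $A$, the map $H^i_c(\hat{\Gamma},A)\to H^i(\Gamma,A)$ induced by $c_\Gamma$, from continuous to ordinary (discrete) group cohomology, is bijective for $0\leq i\leq n$ and injective for $i=n+1$ (equivalently, surjective for $0\le i\le n$). A group $\Gamma$ is highly residually finite if it is residually finite and belongs to $\mathcal{A}_2$; equivalently, for every group extension $1\to F\to E\to \Gamma\to 1$ with $F$ finite, $E$ is residually finite; equivalently, for every group extension $1\to N\to E\to\Gamma\to1$ with $N$ finitely generated and residually finite, $E$ is residually finite. *)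

(* Defs.v *)
From HB Require Import structures.
From mathcomp Require Import all_boot all_algebra.
From mathcomp Require Import boolp classical_sets functions cardinality.
From mathcomp Require Import topology function_spaces.

Set Implicit Arguments.
Unset Strict Implicit.
Unset Printing Implicit Defensive.

Import GRing.Theory.

Local Open Scope classical_set_scope.
Local Open Scope quotient_scope.
Local Open Scope group_scope.

Definition is_subgroup (G : groupType) (H : set G) : Prop :=
  [/\ H 1, (forall x y, H x -> H y -> H (x * y)) & (forall x, H x -> H x^-1)].

Definition normal_in (G : groupType) (N H : set G) : Prop :=
  N `<=` H /\ forall n h, N n -> H h -> N (n ^ h).

(* For N normal in H: the cosets x^k N, k an integer, exhaust H / N. *)
Definition cyclic_factor (G : groupType) (H N : set G) : Prop :=
  exists2 x, H x &
    forall y, H y -> exists k, N ((x ^+ k)^-1 * y) \/ N (x ^+ k * y).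

Definition polycyclic (G : groupType) : Prop :=
  exists (n : nat) (H : nat -> set G),
    [/\ H 0%N = [set: G],
        H n = [set 1],
        (forall i, (i <= n)%N -> is_subgroup (H i)) &
        (forall i, (i < n)%N ->
           normal_in (H i.+1) (H i) /\ cyclic_factor (H i) (H i.+1))].

Section AscendingHNN.
Variables (G : groupType) (phi : G -> G).

(* [inl g] is the letter g, [inr false] the letter t, [inr true] the letter
   t^-1. *)
Definition hnn_letter : choiceType := (G + bool)%type.
Definition hnn_word : choiceType := seq hnn_letter.

(* The congruence on words generated by the multiplication table of G, by
   t t^-1 = t^-1 t = 1 and by t^-1 g t = phi g. *)
Inductive hnn_eq : hnn_word -> hnn_word -> Prop :=
| hnn_refl u : hnn_eq u u
| hnn_sym u v : hnn_eq u v -> hnn_eq v u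
| hnn_trans u v w : hnn_eq u v -> hnn_eq v w -> hnn_eq u w
| hnn_cat u u' v v' : hnn_eq u u' -> hnn_eq v v' -> hnn_eq (u ++ v) (u' ++ v')
| hnn_one : hnn_eq [:: inl 1] [::]
| hnn_mul g h : hnn_eq [:: inl g; inl h] [:: inl (g * h)]
| hnn_tV : hnn_eq [:: inr false; inr true] [::]
| hnn_Vt : hnn_eq [:: inr true; inr false] [::]
| hnn_conj g : hnn_eq [:: inr true; inl g; inr false] [:: inl (phi g)].

Definition hnn_rel : rel hnn_word := fun u v => `[< hnn_eq u v >].

Lemma hnn_rel_equiv : equiv_class_of hnn_rel.
Proof.
split=> [u|u v|v u w]; first by apply/asboolP; exact: hnn_refl.
  by apply/asboolP/asboolP; exact: hnn_sym.
by move=> /asboolP uv /asboolP vw; apply/asboolP; exact: hnn_trans uv vw.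
Qed.

Canonical hnn_equiv := EquivRelPack hnn_rel_equiv.
Canonical hnn_encModRel := defaultEncModRel hnn_rel.

Definition ascending_hnn : Type := {eq_quot hnn_rel}.

HB.instance Definition _ := Choice.on ascending_hnn.
HB.instance Definition _ := EqQuotient.on ascending_hnn.

Lemma hnn_piP (u v : hnn_word) :
  \pi_ascending_hnn u = \pi_ascending_hnn v <-> hnn_eq u v.
Proof.
by split=> [/eqP|uv]; [rewrite piE => /asboolP | apply/eqP; rewrite piE; apply/asboolP].
Qed.

Lemma hnn_reprP (u : hnn_word) : hnn_eq (repr (\pi_ascending_hnn u)) u.
Proof. by apply/hnn_piP; rewrite reprK. Qed.

Definition hnn_letter_inv (l : hnn_letter) : hnn_letter :=
  match l with inl g => inl g^-1 | inr b => inr (~~ b) end.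

Definition hnn_word_inv (u : hnn_word) : hnn_word := rev (map hnn_letter_inv u).

Lemma hnn_word_mulV u : hnn_eq (u ++ hnn_word_inv u) [::].
Proof.
elim: u => [|l u IHu]; first exact: hnn_refl.
have ll : hnn_eq [:: l; hnn_letter_inv l] [::].
  case: l => [g|[]] /=; [|exact: hnn_Vt|exact: hnn_tV].
  by apply: hnn_trans (hnn_mul _ _) _; rewrite mulgV; exact: hnn_one.
apply: hnn_trans ll; rewrite /hnn_word_inv /= rev_cons -cats1 -cat_cons catA.
apply: (@hnn_cat _ [:: l]); last exact: hnn_refl.
exact: (@hnn_cat [:: l] [:: l] _ [::] (hnn_refl _)).
Qed.

Lemma hnn_word_invK : involutive hnn_word_inv.
Proof.
move=> u; rewrite /hnn_word_inv map_rev revK -map_comp map_id_in //.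
by move=> [g|b] _ /=; rewrite ?invgK ?negbK.
Qed.

Lemma hnn_word_Vmul u : hnn_eq (hnn_word_inv u ++ u) [::].
Proof. by rewrite -{2}(hnn_word_invK u); exact: hnn_word_mulV. Qed.

Definition hnn_unit : ascending_hnn := \pi_ascending_hnn [::].
Definition hnn_prod (x y : ascending_hnn) : ascending_hnn :=
  \pi_ascending_hnn (repr x ++ repr y).
Definition hnn_inverse (x : ascending_hnn) : ascending_hnn :=
  \pi_ascending_hnn (hnn_word_inv (repr x)).

Lemma hnn_prodA : associative hnn_prod.
Proof.
move=> x y z; apply/hnn_piP; apply: (@hnn_trans _ (repr x ++ repr y ++ repr z)).
  exact: hnn_cat (hnn_refl _) (hnn_reprP _).
by rewrite catA; apply: hnn_cat (hnn_refl _); apply/hnn_sym/hnn_reprP.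
Qed.

Lemma hnn_prod1g : left_id hnn_unit hnn_prod.
Proof.
move=> x; rewrite -[RHS]reprK; apply/hnn_piP.
by rewrite -[X in hnn_eq _ X]cat0s; apply: hnn_cat (hnn_reprP _) (hnn_refl _).
Qed.

Lemma hnn_prodg1 : right_id hnn_unit hnn_prod.
Proof.
move=> x; rewrite -[RHS]reprK; apply/hnn_piP.
by rewrite -[X in hnn_eq _ X]cats0; apply: hnn_cat (hnn_refl _) (hnn_reprP _).
Qed.

Lemma hnn_prodVg : left_inverse hnn_unit hnn_inverse hnn_prod.
Proof.
move=> x; apply/hnn_piP; apply: hnn_trans (hnn_word_Vmul (repr x)).
exact: hnn_cat (hnn_reprP _) (hnn_refl _).
Qed.

Lemma hnn_prodgV : right_inverse hnn_unit hnn_inverse hnn_prod.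
Proof.
move=> x; apply/hnn_piP; apply: hnn_trans (hnn_word_mulV (repr x)).
exact: hnn_cat (hnn_refl _) (hnn_reprP _).
Qed.

HB.instance Definition _ := isGroup.Build ascending_hnn
  hnn_prodA hnn_prod1g hnn_prodg1 hnn_prodVg hnn_prodgV.

End AscendingHNN.

Record normal_subgroup (G : groupType) := NormalSubgroup {
  normal_set :> set G;
  normal_subgroupP : is_subgroup normal_set;
  normal_conjP : normal_in normal_set [set: G]
}.

Section QuotientGroup.
Variables (G : groupType) (N : normal_subgroup G).

Definition coset_rel : rel G := fun x y => `[< normal_set N (x^-1 * y) >].

Lemma coset_rel_equiv : equiv_class_of coset_rel.
Proof.
have [N1 NM NV] := normal_subgroupP N.
have sym x y : coset_rel x y -> coset_rel y x.
  by move=> /asboolP /NV; rewrite invgM invgK => ?; apply/asboolP.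
split=> [x|x y|y x z]; first by apply/asboolP; rewrite mulVg.
  by apply/idP/idP; exact: sym.
move=> /asboolP xy /asboolP yz; apply/asboolP.
by have := NM _ _ xy yz; rewrite mulgA -(mulgA x^-1) mulgV mulg1.
Qed.

Canonical coset_equiv := EquivRelPack coset_rel_equiv.
Canonical coset_encModRel := defaultEncModRel coset_rel.

Definition quotient_group : Type := {eq_quot coset_rel}.

HB.instance Definition _ := Choice.on quotient_group.
HB.instance Definition _ := EqQuotient.on quotient_group.

Lemma coset_piP (x y : G) :
  \pi_quotient_group x = \pi_quotient_group y <-> normal_set N (x^-1 * y).
Proof.
by split=> [/eqP|xy]; [rewrite piE => /asboolP | apply/eqP; rewrite piE; apply/asboolP].
Qed.

Definition quotient_one : quotient_group := \pi_quotient_group 1.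
Definition quotient_mul (x y : quotient_group) : quotient_group :=
  \pi_quotient_group (repr x * repr y).
Definition quotient_inv (x : quotient_group) : quotient_group :=
  \pi_quotient_group (repr x)^-1.

Lemma quotient_piM (x y : G) :
  \pi_quotient_group (x * y) = quotient_mul (\pi x) (\pi y).
Proof.
have [_ NM _] := normal_subgroupP N; have [_ NJ] := normal_conjP N.
apply/coset_piP; set x' := repr _; set y' := repr _.
have xx' : normal_set N (x^-1 * x') by apply/coset_piP; rewrite reprK.
have yy' : normal_set N (y^-1 * y') by apply/coset_piP; rewrite reprK.
have := NM _ _ (NJ _ y xx' I) yy'.
by rewrite /conjg invgM !mulgA !mulgK.
Qed.

Lemma quotient_piV (x : G) :
  \pi_quotient_group x^-1 = quotient_inv (\pi x).
Proof.
have [_ _ NV] := normal_subgroupP N; have [_ NJ] := normal_conjP N.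
apply/coset_piP; set x' := repr _.
have xx' : normal_set N (x^-1 * x') by apply/coset_piP; rewrite reprK.
have := NV _ (NJ _ x^-1 xx' I).
by rewrite /conjg !(invgM, invgK) !mulgA mulgK.
Qed.

Lemma quotient_mulA : associative quotient_mul.
Proof.
move=> x y z; rewrite -[x]reprK -[y]reprK -[z]reprK.
by rewrite -!quotient_piM mulgA.
Qed.

Lemma quotient_mul1g : left_id quotient_one quotient_mul.
Proof. by move=> x; rewrite -[x]reprK -quotient_piM mul1g. Qed.

Lemma quotient_mulg1 : right_id quotient_one quotient_mul.
Proof. by move=> x; rewrite -[x]reprK -quotient_piM mulg1. Qed.

Lemma quotient_mulVg : left_inverse quotient_one quotient_inv quotient_mul.
Proof.
by move=> x; rewrite -[x]reprK -quotient_piV -quotient_piM mulVg.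
Qed.

Lemma quotient_mulgV : right_inverse quotient_one quotient_inv quotient_mul.
Proof.
by move=> x; rewrite -[x]reprK -quotient_piV -quotient_piM mulgV.
Qed.

HB.instance Definition _ := isGroup.Build quotient_group
  quotient_mulA quotient_mul1g quotient_mulg1 quotient_mulVg quotient_mulgV.

Lemma piMg : {morph \pi_quotient_group : x y / x * y}.
Proof. exact: quotient_piM. Qed.

End QuotientGroup.

Record finite_index_normal (G : groupType) := FiniteIndexNormal {
  finite_index_sub :> normal_subgroup G;
  finite_indexP : finite_set [set: quotient_group finite_index_sub]
}.

HB.instance Definition _ (G : groupType) := gen_eqMixin (finite_index_normal G).

Definition residually_finite (G : groupType) : Prop :=
  forall g : G, g != 1 -> exists N : finite_index_normal G, ~ normal_set N g.

Section ProfiniteCompletion.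
Variable G : groupType.

Definition finite_quotient_prod : Type :=
  prod_topology
    (fun N : finite_index_normal G => discrete_topology (quotient_group N)).

HB.instance Definition _ := Topological.on finite_quotient_prod.

Definition fqp_one : finite_quotient_prod := fun N => (1 : quotient_group N).
Definition fqp_mul (x y : finite_quotient_prod) : finite_quotient_prod :=
  fun N => (x N : quotient_group N) * y N.
Definition fqp_inv (x : finite_quotient_prod) : finite_quotient_prod :=
  fun N => (x N : quotient_group N)^-1.

Lemma fqp_mulA : associative fqp_mul.
Proof. by move=> x y z; apply: functional_extensionality_dep => N; exact: mulgA. Qed.

Lemma fqp_mul1g : left_id fqp_one fqp_mul.
Proof. by move=> x; apply: functional_extensionality_dep => N; exact: mul1g. Qed.

Lemma fqp_mulg1 : right_id fqp_one fqp_mul.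
Proof. by move=> x; apply: functional_extensionality_dep => N; exact: mulg1. Qed.

Lemma fqp_mulVg : left_inverse fqp_one fqp_inv fqp_mul.
Proof. by move=> x; apply: functional_extensionality_dep => N; exact: mulVg. Qed.

Lemma fqp_mulgV : right_inverse fqp_one fqp_inv fqp_mul.
Proof. by move=> x; apply: functional_extensionality_dep => N; exact: mulgV. Qed.

HB.instance Definition _ := isGroup.Build finite_quotient_prod
  fqp_mulA fqp_mul1g fqp_mulg1 fqp_mulVg fqp_mulgV.

(* For N included in M, the coordinate at M is the image of the coordinate at
   N under the projection of G / N onto G / M. *)
Definition compatible : set finite_quotient_prod :=
  [set x | forall N M : finite_index_normal G, N `<=` M ->
     forall g : G, x N = \pi_(quotient_group N) g ->
                   x M = \pi_(quotient_group M) g].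

Lemma compatible_group_closed : group_closed (mem compatible).
Proof.
have ex (x : finite_quotient_prod) (N : finite_index_normal G) :
    exists g : G, x N = \pi_(quotient_group N) g.
  by exists (repr (x N : quotient_group N)); rewrite reprK.
split=> [|x y].
  rewrite inE => N M NM g /coset_piP; rewrite invg1 mul1g => Ng.
  by apply/coset_piP; rewrite invg1 mul1g; exact: NM.
rewrite !inE => cx cy N M NM g.
have [a xN] := ex x N; have [b yN] := ex y N.
have xM := cx N M NM a xN; have yM := cy N M NM b yN.
have piF (K : finite_index_normal G) c d :
    (\pi_(quotient_group K) c : quotient_group K) / \pi_(quotient_group K) d
      = \pi_(quotient_group K) (c / d).
  by rewrite quotient_piM quotient_piV.
have -> : (x / y) N = (x N : quotient_group N) / y N by [].
have -> : (x / y) M = (x M : quotient_group M) / y M by [].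
rewrite xN yN xM yM !piF => /coset_piP abg.
by apply/coset_piP; exact: NM.
Qed.

Definition profinite_completion : Type := set_type compatible.

HB.instance Definition _ := SubType.on profinite_completion.
HB.instance Definition _ := Topological.on profinite_completion.
HB.instance Definition _ :=
  SubChoice_isSubGroup.Build finite_quotient_prod (mem compatible)
    profinite_completion compatible_group_closed.

Definition completion_fun (g : G) : finite_quotient_prod :=
  fun N => \pi_(quotient_group N) g.

Lemma completion_fun_compatible g : completion_fun g \in compatible.
Proof.
rewrite inE => N M NM h /coset_piP gh.
by apply/coset_piP; exact: NM.
Qed.

Definition completion_map (g : G) : profinite_completion :=
  exist _ (completion_fun g) (completion_fun_compatible g).

Lemma completion_map1 : completion_map 1 = 1.
Proof. exact: val_inj. Qed.

Lemma completion_mapM : {morph completion_map : x y / x * y}.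
Proof.
move=> x y; apply: val_inj; apply: functional_extensionality_dep => N.
exact: quotient_piM.
Qed.

End ProfiniteCompletion.

Record gmodule (G : groupType) (A : zmodType) := GModule {
  gact :> G -> A -> A;
  gact1 : forall a, gact 1 a = a;
  gactM : forall g h a, gact (g * h) a = gact g (gact h a);
  gactD : forall g, {morph gact g : a b / (a + b)%R}
}.

Section Cochains.
Variables (G : groupType) (A : zmodType) (M : gmodule G A).

Definition cochain (n : nat) : zmodType := ('I_n -> G) -> A.

(* (g_0, ..., g_n) |-> (g_0, ..., g_i g_(i+1), ..., g_n) *)
Definition merge_at n (i : 'I_n) (g : 'I_n.+1 -> G) : 'I_n -> G :=
  fun j => if (j < i)%N then g (widen_ord (leqnSn n) j)
           else if j == i then g (widen_ord (leqnSn n) j) * g (lift ord0 j)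
           else g (lift ord0 j).

(* Inhomogeneous cochains: (d f)(g_0, ..., g_n) is
   g_0 f(g_1, ..., g_n) + sum_(i < n) (-1)^(i+1) f(..., g_i g_(i+1), ...)
   + (-1)^(n+1) f(g_0, ..., g_(n-1)). *)
Definition differential n (f : cochain n) : cochain n.+1 := fun g =>
  (M (g ord0) (f (fun j => g (lift ord0 j)))
   + \sum_(i < n) f (merge_at i g) *~ ((-1) ^+ i.+1)
   + f (fun j => g (widen_ord (leqnSn n) j)) *~ ((-1) ^+ n.+1))%R.

Lemma gact0 g : M g 0%R = 0%R.
Proof. by apply: (addIr (M g 0%R)); rewrite -gactD !add0r. Qed.

Lemma gactN g : {morph M g : a / (- a)%R}.
Proof. by move=> a; apply: (addIr (M g a)); rewrite -gactD !addNr gact0. Qed.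

Lemma differentialB n (f h : cochain n) :
  differential (f - h)%R = (differential f - differential h)%R.
Proof.
have subE k (u v : cochain k) x : (u - v)%R x = (u x - v x)%R by [].
apply: funext => g; rewrite subE /differential subE gactD gactN subE !mulrzBl.
under eq_bigr => i _ do rewrite subE mulrzBl.
by rewrite sumrB [X in (X + _)%R = _]addrACA -opprD addrACA -opprD.
Qed.

(* Used with all cochains and with the continuous ones; stability under the
   differential is not needed to form cocycles modulo coboundaries. *)
Record cochain_subgroups := CochainSubgroups {
  cochain_set :> forall n, set (cochain n);
  cochain_subgroupsP : forall n,
    @cochain_set n 0%R /\
    forall f h, @cochain_set n f -> @cochain_set n h -> @cochain_set n (f - h)%R
}.

Section Cohomology.
Variables (C : cochain_subgroups) (n : nat).

Definition cocycle_pred : {pred cochain n} :=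
  [pred f | `[< cochain_set C f /\ differential f = 0%R >]].

Lemma differential0 k : differential (0%R : cochain k) = 0%R.
Proof. by rewrite -[X in differential X](subrr 0%R) differentialB subrr. Qed.

Lemma cocycle_zmod_closed : zmod_closed cocycle_pred.
Proof.
have [C0 CB] := cochain_subgroupsP C n.
split=> [|f h]; first by apply/asboolP; split=> //; exact: differential0.
move=> /asboolP[Cf df] /asboolP[Ch dh]; apply/asboolP; split; first exact: CB.
by rewrite differentialB df dh subrr.
Qed.

Definition cocycle : Type := {f : cochain n | f \in cocycle_pred}.

HB.instance Definition _ := SubType.on cocycle.
HB.instance Definition _ := Choice.on cocycle.
HB.instance Definition _ :=
  GRing.SubChoice_isSubZmodule.Build (cochain n) cocycle_pred cocycle
    cocycle_zmod_closed.

Definition coboundary_set : set (cochain n) :=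
  match n return set (cochain n) with
  | 0 => [set 0%R]
  | m.+1 => [set differential h | h in @cochain_set C m]
  end.

Definition coboundary_pred : {pred cocycle} :=
  [pred z | `[< coboundary_set (\val z) >]].

Lemma coboundary_zmod_closed : zmod_closed coboundary_pred.
Proof.
have sB : coboundary_set 0%R /\ forall f h, coboundary_set f ->
    coboundary_set h -> coboundary_set (f - h)%R.
  rewrite /coboundary_set; case: n => [|m].
    by split=> // f h -> ->; rewrite subrr.
  have [C0 CB] := cochain_subgroupsP C m.
  split=> [|_ _ [f Cf <-] [h Ch <-]]; first by exists 0%R => //; exact: differential0.
  by exists (f - h)%R; [exact: CB | exact: differentialB].
split=> [|x y]; first by apply/asboolP; rewrite raddf0; exact: sB.1.
by move=> /asboolP xB /asboolP yB; apply/asboolP; rewrite raddfB; exact: sB.2.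
Qed.

HB.instance Definition _ :=
  GRing.isZmodClosed.Build cocycle coboundary_pred coboundary_zmod_closed.

Definition cohomology : zmodType := {ideal_quot coboundary_pred}.

Definition cohomology_class (z : cocycle) : cohomology :=
  \pi_{ideal_quot coboundary_pred} z.

Lemma cohomology_class_eq (z z' : cocycle) :
  cohomology_class z = cohomology_class z' <->
  coboundary_set (\val z - \val z')%R.
Proof.
split=> [/eqP|zz'].
  by rewrite -[_ == _]Quotient.idealrBE => /asboolP; rewrite raddfB.
by apply/eqP; rewrite -[_ == _]Quotient.idealrBE; apply/asboolP; rewrite raddfB.
Qed.

End Cohomology.

Definition all_cochains : cochain_subgroups :=
  @CochainSubgroups (fun _ => setT) (fun _ => conj I (fun _ _ _ _ => I)).

End Cochains.

Arguments cocycle_pred {G A} M C n _.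

Section Comparison.
Variables (G : groupType) (A : zmodType).
Local Notation Ghat := (profinite_completion G).

Definition continuous_cochain n (f : cochain Ghat A n) : Prop :=
  continuous (f : {ptws 'I_n -> Ghat} -> discrete_topology A).

Lemma continuous_cochainP n (f : cochain Ghat A n) :
  continuous_cochain f <->
  forall x : {ptws 'I_n -> Ghat}, \forall y \near x, f y = f x.
Proof.
split=> cf x; first by apply: (cf x [set f x]); exact: discrete_set1.
move=> U /= /principal_filterP Ufx;  apply: (@filterS _ _ (nbhs_filter x) _ _ _ (cf x)) => y /= ->.
exact: Ufx.
Qed.

Lemma continuous_cochain_subproof n :
  continuous_cochain (0%R : cochain Ghat A n) /\
  forall f h : cochain Ghat A n, continuous_cochain f -> continuous_cochain h ->
    continuous_cochain (f - h)%R.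
Proof.
split=> [|f h /continuous_cochainP cf /continuous_cochainP ch].
  by apply/continuous_cochainP => x; by apply: (@nearW _ _ _ (nbhs_filter x)) => y.
apply/continuous_cochainP => x; apply: (@filterS2 _ _ (nbhs_filter x) _ _ _ _ (cf x) (ch x)) => y fy hy.
by rewrite -[LHS]/(f y - h y)%R fy hy.
Qed.

Definition continuous_cochains : cochain_subgroups Ghat A :=
  CochainSubgroups continuous_cochain_subproof.

Section CompletionModule.
Variable M : gmodule Ghat A.

Definition completion_gact (g : G) : A -> A := M (completion_map g).

Lemma completion_gact1 a : completion_gact 1 a = a.
Proof. by rewrite /completion_gact completion_map1 gact1. Qed.

Lemma completion_gactM g h a :
  completion_gact (g * h) a = completion_gact g (completion_gact h a).
Proof. by rewrite /completion_gact completion_mapM gactM. Qed.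

Lemma completion_gactD g : {morph completion_gact g : a b / (a + b)%R}.
Proof. exact: gactD. Qed.

Definition completion_gmodule : gmodule G A :=
  GModule completion_gact1 completion_gactM completion_gactD.

Definition cohomology_hat n : zmodType :=
  cohomology M continuous_cochains n.

Definition cohomology_discrete n : zmodType :=
  cohomology completion_gmodule (all_cochains G A) n.

Definition pullback n (f : cochain Ghat A n) : cochain G A n :=
  fun g => f (fun i => completion_map (g i)).

Lemma pullbackB n (f h : cochain Ghat A n) :
  pullback (f - h)%R = (pullback f - pullback h)%R.
Proof. by []. Qed.

Lemma pullback_differential n (f : cochain Ghat A n) :
  pullback (differential M f) = differential completion_gmodule (pullback f).
Proof.
apply: funext => g; rewrite /pullback /differential; congr (_ + _ + _)%R.
apply: eq_bigr => i _; congr (f _ *~ _)%R; apply: funext => j.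
rewrite /merge_at; case: ifP => // _; case: ifP => // _.
by rewrite completion_mapM.
Qed.

Lemma pullback_cocycle n (z : cocycle M continuous_cochains n) :
  pullback (\val z) \in cocycle_pred completion_gmodule (all_cochains G A) n.
Proof.
have /asboolP[_ dz] := valP z.
by apply/asboolP; split=> //; rewrite -pullback_differential dz.
Qed.

Definition pullback_cocycles n (z : cocycle M continuous_cochains n) :
    cocycle completion_gmodule (all_cochains G A) n :=
  exist _ (pullback (\val z)) (pullback_cocycle z).

Definition comparison_map n (x : cohomology_hat n) : cohomology_discrete n :=
  cohomology_class (pullback_cocycles (repr x)).

Lemma comparison_mapE n (z : cocycle M continuous_cochains n) :
  comparison_map (cohomology_class z) = cohomology_class (pullback_cocycles z).
Proof.
apply/cohomology_class_eq; rewrite -pullbackB.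
set z' := repr _; have /cohomology_class_eq : cohomology_class z' = cohomology_class z.
  exact: reprK.
case: n z @z' => [|n] z z' /=; first by rewrite /coboundary_set /= => ->.
move=> [h _ <-]; rewrite pullback_differential.
by exists (pullback h).
Qed.

Definition continuous_action : Prop :=
  continuous (fun p : Ghat * discrete_topology A =>
    M p.1 p.2 : discrete_topology A).

End CompletionModule.
End Comparison.

Definition class_A (n : nat) (G : groupType) : Prop :=
  forall (A : finZmodType) (M : gmodule (profinite_completion G) A),
    continuous_action M ->
    (forall i, (i <= n)%N -> bijective (@comparison_map G A M i)) /\
    injective (@comparison_map G A M n.+1).

Definition highly_residually_finite (G : groupType) : Prop :=
  residually_finite G /\ class_A 2 G.

(* Main.v *)
Require Import Defs.
From HB Require Import structures.
From mathcomp Require Import all_boot all_algebra.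
From mathcomp Require Import boolp classical_sets functions cardinality.
From mathcomp Require Import filter topology function_spaces.
From mathcomp Require Import zify.

(**
Let H be polycyclic with an injective endomorphism phi, and let p <> 1 in H.
A finite-index normal subgroup M of H missing p with phi^-1(M) = M yields a
finite quotient of the ascending HNN extension in which p survives.  Such an M
is found by induction on the number of infinite factors of H.  The subgroup K
generated by the m-th powers has, for suitable m, only bounded roots; as H is
noetherian, replacing it by some phi^-k(K) gives phi^-1(K) = K.  If p is in K,
take the last nontrivial derived subgroup of K and saturate it in the same way
to an abelian normal V with phi^-1(V) = V.  The quotient V / phi(V) has finite
exponent d, so for q = dB + 1 the subgroup U of q-th powers in V satisfies
phi^-1(U) = U and misses p as soon as B bounds the roots of p; H / U has fewer
infinite factors.

A finite abelian extension of the HNN extension is again an ascending union of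
polycyclic groups extended by the lift of t, hence residually finite.  This
says that 2-cocycles with finite coefficients become inflated from a finite
quotient after adding a coboundary, i.e. surjectivity in degree 2; injectivity
in degree 3 follows by embedding the coefficients in a coinduced module.
*)

Set Implicit Arguments.
Unset Strict Implicit.
Unset Printing Implicit Defensive.

Import GRing.Theory.

Local Open Scope classical_set_scope.
Local Open Scope quotient_scope.
Local Open Scope group_scope.

(** * Subgroups, integer powers and congruences *)

(** The equality phi^-1(M) = M is stronger than phi(M) being contained in M, and it is what a finite
    quotient requires: phi then induces an injective map of the finite group H / M, hence an
    automorphism of finite order, and some power of t together with the union of the conjugates t^k
    M t^-k forms a normal subgroup of finite index meeting H exactly in M. Full invariance does not
    give this equality: for doubling on Z, the preimage of 2Z is Z. Replacing a subgroup by its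
    preimages under phi^k restores the equality but enlarges the subgroup, possibly until it
    swallows p. Inside V this is avoided by arithmetic: q is prime to d, so the q-th powers satisfy
    the equality from the start. Bounded roots serve twice: they keep p from being a q-th power, and
    they make K torsion-free, so that dividing by any nontrivial subgroup of K lowers the number of
    infinite factors. *)

Section Morphisms.
Variables (G K : groupType) (f : G -> K).
Hypothesis fM : {morph f : x y / x * y}.

Lemma morphg1 : f 1 = 1.
Proof. by apply: (mulgI (f 1)); rewrite -fM !mulg1. Qed.

Lemma morphgV : {morph f : x / x^-1}.
Proof. by move=> x; apply: (mulgI (f x)); rewrite -fM !mulgV morphg1. Qed.

Lemma morphgJ : {morph f : x y / x ^ y}.
Proof. by move=> x y; rewrite /conjg !fM morphgV. Qed.

Lemma morphgX n : {morph f : x / x ^+ n}.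
Proof.
by move=> x; elim: n => [|n IHn]; rewrite ?expg0 ?morphg1 // !expgS fM IHn.
Qed.

End Morphisms.

Definition zexpg (G : groupType) (x : G) (z : int) : G :=
  match z with Posz n => x ^+ n | Negz n => x ^- n.+1 end.

Section IntegerPowers.
Variable G : groupType.
Implicit Types (x y : G) (a b : int).

Lemma zexpgS x a : zexpg x (a + 1)%R = zexpg x a * x.
Proof.
case: a => [n|[|n]]; first by rewrite -PoszD addn1 /= expgSr.
  by rewrite /= expg1 mulVg.
have -> : (Negz n.+1 + 1)%R = Negz n by lia.
by rewrite /= [X in _ = X^-1 * _]expgS invgM -mulgA mulVg mulg1.
Qed.

Lemma zexpgP x a : zexpg x (a - 1)%R = zexpg x a * x^-1.
Proof. by rewrite -{2}[a](@subrK _ 1%R) zexpgS mulgK. Qed.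

Lemma zexpgD x a b : zexpg x (a + b)%R = zexpg x a * zexpg x b.
Proof.
elim/int_rect: b => [|n IHn|n IHn]; first by rewrite addr0 /= mulg1.
  by rewrite -addn1 PoszD addrA !zexpgS IHn mulgA.
have -> : (- (n.+1)%:Z)%R = (- n%:Z - 1)%R by lia.
by rewrite addrA !zexpgP IHn mulgA.
Qed.

Lemma zexpgN x a : zexpg x (- a)%R = (zexpg x a)^-1.
Proof. by apply: (mulgI (zexpg x a)); rewrite -zexpgD subrr mulgV. Qed.

Lemma zexpgM x a b : zexpg x (a * b)%R = zexpg (zexpg x a) b.
Proof.
elim/int_rect: b => [|n IHn|n IHn]; first by rewrite mulr0.
  by rewrite -addn1 PoszD mulrDr mulr1 zexpgS zexpgD IHn.
have -> : (- (n.+1)%:Z)%R = (- n%:Z - 1)%R by lia.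
by rewrite mulrBr mulr1 zexpgP -IHn zexpgD (zexpgN x a).
Qed.

Lemma zexpgX x a n : zexpg x a ^+ n = zexpg x (a * n%:Z)%R.
Proof. by rewrite zexpgM. Qed.

Lemma zexpg_commute x a b : commute (zexpg x a) (zexpg x b).
Proof. by rewrite /commute -!zexpgD addrC. Qed.

Lemma morph_zexpg (K : groupType) (f : G -> K) :
  {morph f : x y / x * y} -> forall x a, f (zexpg x a) = zexpg (f x) a.
Proof.
by move=> fM x [n|n] /=; rewrite ?(morphgV fM) (morphgX fM).
Qed.

End IntegerPowers.

Section Subgroups.
Variable G : groupType.
Implicit Types (N H C : set G).

Lemma subgroupX H x n : is_subgroup H -> H x -> H (x ^+ n).
Proof.
by move=> [H1 HM HV] Hx; elim: n => [|n IHn] //; rewrite expgS; apply: HM.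
Qed.

Lemma subgroupZ H x a : is_subgroup H -> H x -> H (zexpg x a).
Proof.
move=> sH Hx; have [_ _ HV] := sH.
by case: a => n /=; [|apply: HV]; apply: subgroupX.
Qed.

Lemma subgroupI H C : is_subgroup H -> is_subgroup C -> is_subgroup (H `&` C).
Proof.
move=> [H1 HM HV] [C1 CM CV]; split=> // [x y [Hx Cx] [Hy Cy]|x [Hx Cx]].
  by split; [apply: HM | apply: CM].
by split; [apply: HV | apply: CV].
Qed.

Lemma subgroup_setT : is_subgroup [set: G]. Proof. by split. Qed.

Lemma subgroup_set1 : is_subgroup [set 1 : G].
Proof.
split=> // [x y -> ->|x ->]; first exact: mulg1.
exact: invg1.
Qed.

Lemma subgroup_preimage (K : groupType) (f : G -> K) (C : set K) :
  {morph f : x y / x * y} -> is_subgroup C -> is_subgroup (f @^-1` C).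
Proof.
move=> fM [C1 CM CV]; split=> [|x y fx fy|x fx]; rewrite /preimage /=.
- by rewrite (morphg1 fM).
- by rewrite fM; apply: CM.
- by rewrite (morphgV fM); apply: CV.
Qed.

Lemma subgroup_image (K : groupType) (f : G -> K) H :
  {morph f : x y / x * y} -> is_subgroup H -> is_subgroup (f @` H).
Proof.
move=> fM [H1 HM HV]; split.
- by exists 1; rewrite ?(morphg1 fM).
- by move=> _ _ [x Hx <-] [y Hy <-]; exists (x * y); [apply: HM|rewrite fM].
- by move=> _ [x Hx <-]; exists x^-1; [apply: HV|rewrite (morphgV fM)].
Qed.

(** [N] is a bare set, so the same congruence serves subgroups that are normal only in some term of
    a series. *)
Definition cong N (x y : G) := N (x^-1 * y).

Lemma cong_refl N x : is_subgroup N -> cong N x x.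
Proof. by move=> [N1 _ _]; rewrite /cong mulVg. Qed.

Lemma cong_sym N x y : is_subgroup N -> cong N x y -> cong N y x.
Proof. by move=> [_ _ NV] /NV; rewrite invgM invgK. Qed.

Lemma cong_trans N x y z :
  is_subgroup N -> cong N x y -> cong N y z -> cong N x z.
Proof.
by move=> [_ NM _] xy yz; have := NM _ _ xy yz; rewrite !mulgA mulgK.
Qed.

Lemma congMl N z x y : cong N x y -> cong N (z * x) (z * y).
Proof. by rewrite /cong invgM !mulgA mulgVK. Qed.

Lemma cong1 N x : cong N 1 x <-> N x.
Proof. by rewrite /cong invg1 mul1g. Qed.

Section Normal.
Variables (N H : set G).
Hypotheses (sN : is_subgroup N) (sH : is_subgroup H) (nNH : normal_in N H).

Lemma congM x x' y y' :
  H y -> cong N x x' -> cong N y y' -> cong N (x * y) (x' * y').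
Proof.
move=> Hy xx' yy'; have [_ NM _] := sN; have [_ NJ] := nNH.
by have := NM _ _ (NJ _ _ xx' Hy) yy'; rewrite /cong /conjg invgM !mulgA mulgK.
Qed.

Lemma congV x x' : H x -> cong N x x' -> cong N x^-1 x'^-1.
Proof.
move=> Hx xx'; have [_ _ NV] := sN; have [_ NJ] := nNH; have [_ _ HV] := sH.
have := NJ _ _ (NV _ xx') (HV _ Hx).
by rewrite /cong /conjg invgM !invgK !mulgA mulgK.
Qed.

Lemma congX x x' n : H x -> cong N x x' -> cong N (x ^+ n) (x' ^+ n).
Proof.
move=> Hx xx'; elim: n => [|n IHn]; first exact: cong_refl.
by rewrite !expgS; apply: congM => //; apply: subgroupX.
Qed.

Lemma congZ x x' a : H x -> cong N x x' -> cong N (zexpg x a) (zexpg x' a).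
Proof.
move=> Hx xx'; case: a => n /=; first exact: congX.
by apply: congV; [apply: subgroupX|apply: congX].
Qed.

Lemma congJ x x' y : H y -> cong N x x' -> cong N (x ^ y) (x' ^ y).
Proof.
move=> Hy xx'; have [_ NJ] := nNH.
by rewrite /cong -conjVg -conjMg; apply: NJ.
Qed.

End Normal.

Definition generated (S : set G) : set G :=
  [set x | forall C, is_subgroup C -> S `<=` C -> C x].

Lemma generated_subgroup S : is_subgroup (generated S).
Proof.
split=> [C [C1 _ _] _ //|x y Sx Sy C sC SC|x Sx C sC SC]; have [_ CM CV] := sC.
  by apply: CM; [apply: Sx|apply: Sy].
by apply: CV; apply: Sx.
Qed.

Lemma sub_generated S : S `<=` generated S.
Proof. by move=> x Sx C _; apply. Qed.

Lemma generated_sub S C : is_subgroup C -> S `<=` C -> generated S `<=` C.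
Proof. by move=> sC SC x; apply. Qed.

Lemma generated_stable S (f : G -> G) : {morph f : x y / x * y} ->
  (forall x, S x -> generated S (f x)) ->
  forall x, generated S x -> generated S (f x).
Proof.
move=> fM Sf; apply: (@generated_sub _ (f @^-1` generated S)) => //.
by apply: subgroup_preimage => //; apply: generated_subgroup.
Qed.

End Subgroups.

(** The generators [x i] of the factors are part of the data; integer exponents merge the two
    alternatives of [cyclic_factor]. *)
Definition pc_series (G : groupType) (l : nat) (H : nat -> set G)
    (x : nat -> G) : Prop :=
  [/\ H 0%N = setT, H l = [set 1],
      (forall i, (i <= l)%N -> is_subgroup (H i)),
      (forall i, (i < l)%N -> normal_in (H i.+1) (H i)) &
      (forall i, (i < l)%N -> H i (x i) /\
         forall y, H i y -> exists a, cong (H i.+1) (zexpg (x i) a) y)].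

Lemma polycyclic_series (G : groupType) :
  polycyclic G -> exists l H x, @pc_series G l H x.
Proof.
move=> [l [H [H0 Hl sH cH]]].
have /choice[x xP] : forall i, exists x, (i < l)%N -> H i x /\
    forall y, H i y -> exists a, cong (H i.+1) (zexpg x a) y.
  move=> i; case: (ltnP i l) => [il|_]; last by exists 1.
  have [_ [x Hx xP]] := cH i il; exists x => _; split=> // y /xP[k [ky|ky]].
    by exists (Posz k).
  exists (- k%:Z)%R; rewrite /cong zexpgN invgK; exact: ky.
exists l, H, x; split=> // [i il]; exact: (cH i il).1.
Qed.

Section Series.
Variables (G : groupType) (l : nat) (H : nat -> set G) (x : nat -> G).
Hypothesis pcH : pc_series l H x.

Let sH i : (i <= l)%N -> is_subgroup (H i).
Proof. by case: pcH => _ _ h _ _; apply: h. Qed.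
Let nH i : (i < l)%N -> normal_in (H i.+1) (H i).
Proof. by case: pcH => _ _ _ h _; apply: h. Qed.
Let Hx i : (i < l)%N -> H i (x i).
Proof. by case: pcH => _ _ _ _ h /h[]. Qed.
Let xP i y : (i < l)%N -> H i y -> exists a, cong (H i.+1) (zexpg (x i) a) y.
Proof. by case: pcH => _ _ _ _ h /h[_]; apply. Qed.

Lemma series_ind (P : nat -> Prop) :
  P l -> (forall i, (i < l)%N -> P i.+1 -> P i) -> forall i, (i <= l)%N -> P i.
Proof.
move=> Pl PS i il; rewrite -(subKn il).
elim: (l - i)%N (leq_subr i l) => [|j IHj] jl; first by rewrite subn0.
apply: PS; first by lia.
by have -> : (l - j.+1).+1 = (l - j)%N; [lia|apply: IHj; lia].
Qed.

(** Generators of the intersection of [U] with [H i.+1] are completed by one element of [U] that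
    generates the image of [U] in the cyclic factor. *)
Lemma pc_fg (U : set G) : is_subgroup U -> exists s : seq G,
  (forall u, u \in s -> U u) /\
  forall C, is_subgroup C -> (forall u, u \in s -> C u) -> U `<=` C.
Proof.
have [H0 Hl _ _ _] := pcH.
suff ind i : (i <= l)%N -> forall U, is_subgroup U -> U `<=` H i ->
  exists s : seq G, (forall u, u \in s -> U u) /\
    forall C, is_subgroup C -> (forall u, u \in s -> C u) -> U `<=` C.
  by move=> sU; apply: (ind 0%N) => //; rewrite H0.
move: i; apply: series_ind => [|i il IHi] {}U sU UH.
  exists [::]; split=> // C [C1 _ _] _ u /UH; rewrite Hl => -> //.
have sH1 := sH il; have sHi := sH (ltnW il); have nHi := nH il.
have [s' [s'U s'P]] := IHi _ (subgroupI sU sH1) (@subIsetr _ _ _).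
have [U1 UM UV] := sU; have Hxi := Hx il.
pose P c := `[< (0 < c)%N /\ exists2 u, U u & cong (H i.+1) (x i ^+ c) u >].
(* Without a positive exponent the image of [U] in the factor is trivial, since inverting turns a
   negative exponent into a positive one; then [U] lies in [H i.+1]. *)
have [[c Pc]|nP] := pselect (exists c, P c); last first.
  exists s'; split=> [u /s'U[] //|C sC /(s'P C sC) UC u Uu]; apply: UC; split=> //.
  have [a au] := xP il (UH _ Uu).
  have nPn n v : U v -> cong (H i.+1) (x i ^+ n.+1) v -> False.
    by move=> Uv nv; apply: nP; exists n.+1; apply/asboolP; split=> //; exists v.
  case: a au => [[|n]|n] au.
  - by rewrite -cong1.
  - by case: (nPn n u).
  - case: (nPn n u^-1 (UV _ Uu)); rewrite -[x i ^+ n.+1]invgK.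
    apply: (congV sH1 sHi nHi) => //.
    by apply: (@subgroupZ _ _ _ (Negz n)).
have := ex_minnP (ex_intro _ c Pc) => -[g /asboolP[g0 [u Uu gu]] gmin] {c Pc}.
exists (u :: s'); split=> [v|C sC Cs].
  by rewrite inE => /predU1P[->//|/s'U[]].
have Cu : C u by apply: Cs; rewrite mem_head.
have {}s'P := s'P C sC (fun v vs => Cs v (@mem_behead _ (u :: s') v vs)).
move=> y Uy; have [a ay] := xP il (UH _ Uy).
(* The remainder modulo the least exponent [g] is again the exponent of an element of [U], so
   minimality makes it zero. *)
pose q := (a %/ Posz g)%Z; pose r := (a %% Posz g)%Z.
have Uyq : U (y * zexpg u (- q)%R) by apply: UM => //; apply: subgroupZ.
have Hu : H i u by apply: UH.
have ryq : cong (H i.+1) (zexpg (x i) r) (y * zexpg u (- q)%R).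
  have -> : r = (a + g%:Z * (- q))%R.
    by rewrite /r /q {2}(divz_eq a (Posz g)); lia.
  rewrite zexpgD zexpgM; apply: (congM sH1 nHi) => //.
    by do 2 apply: subgroupZ => //.
  by apply: (congZ sH1 sHi nHi) => //; apply: subgroupX.
have r_ge : (0 <= r)%R by rewrite modz_ge0 //; lia.
have r_lt : (r < g%:Z)%R by rewrite ltz_pmod //; lia.
have r0 : r = 0%R.
  case: (r) ryq r_ge r_lt => // -[//|n] nyq _ ng.
  have /gmin : P n.+1 by apply/asboolP; split=> //; exists (y * zexpg u (- q)%R).
  by lia.
have Cyq : C (y * zexpg u (- q)%R).
  by apply: s'P; split=> //; rewrite -cong1 -[1]/(zexpg (x i) 0%R) -r0.
have [_ CM _] := sC; rewrite -[y](mulgK (zexpg u (- q)%R)) -zexpgN.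
by apply: CM => //; apply: subgroupZ.
Qed.

(** The union of the chain is a finitely generated subgroup, and its generators already lie in one
    term. *)
Lemma pc_acc (C : nat -> set G) :
  (forall k, is_subgroup (C k)) -> (forall k, C k `<=` C k.+1) ->
  exists k, C k.+1 `<=` C k.
Proof.
move=> sC CS.
have mono k n : C k `<=` C (k + n)%N.
  elim: n => [|n IHn]; first by rewrite addn0.
  by rewrite addnS => y /IHn; apply: CS.
pose U := [set y | exists k, C k y].
have sU : is_subgroup U.
  split=> [|y z [k ky] [n nz]|y [k ky]].
  - by exists 0%N; case: (sC 0%N).
  - exists (k + n)%N; have [_ CM _] := sC (k + n)%N.
    by apply: CM; [apply: mono|rewrite addnC; apply: mono].
  - by exists k; case: (sC k) => _ _; apply.
have [s [sU' sP]] := pc_fg sU.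
suff [k kP] : exists k, forall u, u \in s -> C k u.
  by exists k => y Cy; apply: (sP _ (sC k) kP); exists k.+1.
elim: s sU' {sP} => [|u s IHs] sU'; first by exists 0%N.
have [|k kP] := IHs; first by move=> v vs; apply: sU'; rewrite inE vs orbT.
have [n nu] := sU' u (mem_head u s).
exists (k + n)%N => v; rewrite inE => /predU1P[->|/kP]; last exact: mono.
by rewrite addnC; apply: mono.
Qed.

End Series.

(** * Roots in polycyclic groups *)

Lemma nat_ffun_collision (T : finType) (F : nat -> T) :
  exists c d, [/\ (c < d)%N & F c = F d].
Proof.
apply: contrapT => nF.
have inj : injective (fun i : 'I_(#|T|.+1) => F i).
  move=> i j Fij; apply/val_inj; apply: contrapT => /eqP.
  by rewrite neq_ltn => /orP[] ij; apply: nF; [exists i, j|exists j, i].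
by have := leq_card _ inj; rewrite card_ord ltnn.
Qed.

Section ConjugationOrder.
Variables (G : groupType) (N L : set G) (s : seq G) (x : G).
Hypotheses (sL : is_subgroup L) (sN : is_subgroup N).
Hypotheses (Nx : forall y, N y -> N (y ^ x)) (Lx : forall y, L y -> L (y ^ x)).
Hypothesis Lx' : forall y, N y -> L (y ^ x) -> L y.
Hypotheses (Ns : forall r, r \in s -> N r).
Hypothesis reps : forall y, N y -> exists2 r, r \in s & cong L r y.

(** Conjugation by [x] acts on the finite coset space [N / L], injectively by [Lx'], hence as a
    permutation of finite order. *)
Lemma conj_power_cong : exists n, (0 < n)%N /\
  forall y, N y -> cong L y (y ^ (x ^+ n)).
Proof.
have NxX n y : N y -> N (y ^ (x ^+ n)).
  by elim: n y => [|n IHn] y Ny; rewrite ?conjg1 // expgS conjgM; apply/IHn/Nx.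
have LxX n y : L y -> L (y ^ (x ^+ n)).
  by elim: n y => [|n IHn] y Ny; rewrite ?conjg1 // expgS conjgM; apply/IHn/Lx.
have LxX' n y : N y -> L (y ^ (x ^+ n)) -> L y.
  elim: n y => [|n IHn] y Ny; rewrite ?conjg1 // expgS conjgM => /IHn h.
  by apply/Lx' => //; apply/h/Nx.
(* The successor keeps the index type nonempty, so that elements outside [N] can receive [ord0]. *)
have /choice[rho rhoP] : forall y, exists i : 'I_(size s).+1,
    N y -> (i < size s)%N /\ cong L (nth 1 s i) y.
  move=> y; have [Ny|nNy] := pselect (N y); last by exists ord0.
  have [r rs ry] := reps Ny; have ls : (index r s < size s)%N by rewrite index_mem.
  by exists (Ordinal (ltnW ls : (index r s < (size s).+1)%N)); rewrite /= nth_index.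
(* There are finitely many tables of representatives, so two powers of [x] induce the same map on
   [N / L]; [LxX'] then cancels the smaller one. *)
have [c [d [cd Fcd]]] := nat_ffun_collision
  (fun c => [ffun j : 'I_(size s) => rho (nth 1 s j ^ (x ^+ c))]).
exists (d - c)%N; split=> [|y Ny]; first by rewrite subn_gt0.
have [_ LM LV] := sL; have [_ NM NV] := sN.
have [js jy] := rhoP y Ny; move: (rho y : nat) js jy => j js jy.
have Nj : N (nth 1 s j) by apply/Ns/mem_nth.
have Lj : L ((nth 1 s j)^-1 * nth 1 s j ^ (x ^+ (d - c))).
  apply: (LxX' c); first by apply: NM; [apply: NV|apply: NxX].
  rewrite conjMg -conjgM -expgnDr (subnK (ltnW cd)) conjVg.
  have /ffunP/(_ (Ordinal js)) := Fcd; rewrite !ffunE /= => rhoE.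
  have [_ hc] := rhoP _ (NxX c _ Nj); have [_ hd] := rhoP _ (NxX d _ Nj).
  apply: (@cong_trans _ _ _ (nth 1 s (rho (nth 1 s j ^ x ^+ c))) _ sL).
    exact: cong_sym.
  by rewrite rhoE.
rewrite /cong.
have -> : y^-1 * y ^ (x ^+ (d - c)) = ((nth 1 s j)^-1 * y)^-1 *
    ((nth 1 s j)^-1 * nth 1 s j ^ (x ^+ (d - c))) *
    ((nth 1 s j)^-1 * y) ^ (x ^+ (d - c)).
  rewrite conjMg conjVg; move: (y ^ _) (nth 1 s j ^ _) => a b.
  by rewrite invgM invgK !mulgA !mulgK.
by apply: (LM); [apply: LM; [apply: LV|]|apply: LxX].
Qed.

End ConjugationOrder.

(** Excludes torsion and infinitely divisible elements of [K] at once. *)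
Definition bounded_roots (G : groupType) (K : set G) : Prop :=
  forall p, K p -> p <> 1 ->
    exists B : nat, forall q w, K w -> w ^+ q = p -> (q <= B)%N.

Lemma bounded_roots_sub (G : groupType) (K L : set G) :
  K `<=` L -> bounded_roots L -> bounded_roots K.
Proof.
move=> KL bL p /KL Lp p1; have [B BP] := bL p Lp p1.
by exists B => q w /KL; apply: BP.
Qed.

Section PowerSubgroup.
Variable G : groupType.
Implicit Types H : set G.

Definition power_subgroup (m : nat) H : set G :=
  generated [set y ^+ m | y in H].

Lemma power_subgroupP m H : is_subgroup (power_subgroup m H).
Proof. exact: generated_subgroup. Qed.

Lemma power_subgroup_mem m H y : H y -> power_subgroup m H (y ^+ m).
Proof. by move=> Hy; apply: sub_generated; exists y. Qed.

Lemma power_subgroup_sub m H : is_subgroup H -> power_subgroup m H `<=` H.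
Proof.
by move=> sH; apply: generated_sub => // _ [y Hy <-]; apply: subgroupX.
Qed.

Lemma power_subgroup_stable m H (f : G -> G) : {morph f : x y / x * y} ->
  (forall y, H y -> H (f y)) ->
  forall y, power_subgroup m H y -> power_subgroup m H (f y).
Proof.
move=> fM Hf; apply: generated_stable => // _ [y Hy <-].
by rewrite (morphgX fM); apply: power_subgroup_mem; apply: Hf.
Qed.

End PowerSubgroup.

Section SeriesRoots.
Variables (G : groupType) (l : nat) (H : nat -> set G) (x : nat -> G).
Hypothesis pcH : pc_series l H x.

Let sH i : (i <= l)%N -> is_subgroup (H i).
Proof. by case: pcH => _ _ h _ _; exact: (h i). Qed.
Let nH i : (i < l)%N -> normal_in (H i.+1) (H i).
Proof. by case: pcH => _ _ _ h _; exact: (h i). Qed.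
Let Hx i : (i < l)%N -> H i (x i).
Proof. by case: pcH => _ _ _ _ h /h[]. Qed.
Let xP i y : (i < l)%N -> H i y -> exists a, cong (H i.+1) (zexpg (x i) a) y.
Proof. by case: pcH => _ _ _ _ h /h[_]; apply. Qed.

(** A polycyclic group of finite exponent is finite: modulo [L], each generator [x i] occurs only
    with exponents below [m]. *)
Lemma pc_finite_reps i (L : set G) m : (i <= l)%N -> is_subgroup L ->
  (forall n h, L n -> H i h -> L (n ^ h)) -> (0 < m)%N ->
  (forall y, H i y -> L (y ^+ m)) ->
  exists s : seq G, (forall r, r \in s -> H i r) /\
    forall y, H i y -> exists2 r, r \in s & cong L r y.
Proof.
move=> il sL + m0; have [_ LM LV] := sL.
move: i il; apply: (series_ind (l := l)) => [_ _|i il IHi LJ Lm].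
  have [_ Hl _ _ _] := pcH; exists [:: 1]; split=> [r|y]; rewrite Hl.
    by rewrite inE => /eqP.
  by move=> ->; exists 1; rewrite ?inE //; apply: cong_refl.
have [HS nHS] := nH il; have sHi := sH (ltnW il); have Hxi := Hx il.
have [_ HM _] := sHi.
have [n h Ln Hh|y Hy|s [sH' sP]] := IHi _ _; [by apply/LJ/HS|by apply/Lm/HS|].
exists [seq x i ^+ k * r | k <- iota 0 m, r <- s]; split=> [_ /allpairsP[[k r] /= [_ rs ->]]|y Hy].
  by apply: HM; [apply: subgroupX|apply/HS/sH'].
have [a ay] := xP il Hy; have [r rs ry] := sP _ ay.
pose q := (a %/ Posz m)%Z; pose c := (a %% Posz m)%Z.
have c_ge : (0 <= c)%R by rewrite modz_ge0 //; lia.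
have c_lt : (c < Posz m)%R by rewrite ltz_pmod //; lia.
have aE : a = (c + Posz m * q)%R by rewrite {1}(divz_eq a (Posz m)) /c /q; lia.
case: (c) c_ge c_lt aE => // k _ km aE.
exists (x i ^+ k * r).
  by apply/allpairsP; exists (k, r); split=> //; rewrite mem_iota /=; lia.
have yE : y = x i ^+ k * zexpg (x i ^+ m) q * ((zexpg (x i) a)^-1 * y).
  by rewrite {1}aE zexpgD zexpgM /= mulgA mulgV mul1g.
have -> : cong L (x i ^+ k * r) y = L (zexpg (x i ^+ m) q ^ r *
    (r^-1 * ((zexpg (x i) a)^-1 * y))).
  by rewrite /cong [in LHS]yE; congr (L _); rewrite /conjg invgM !mulgA mulgVK mulgK.
apply: LM ry; apply: LJ; last by apply/HS/sH'.
by apply: subgroupZ => //; apply: Lm.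
Qed.

Lemma pc_bounded_roots i : (i <= l)%N ->
  exists m, (0 < m)%N /\ bounded_roots (power_subgroup m (H i)).
Proof.
move: i; apply: (series_ind (l := l)) => [|i il [m [m0 brL]]].
  exists 1%N; split=> // p; have [_ Hl _ _ _] := pcH.
  move=> /power_subgroup_sub; rewrite Hl => /(_ (subgroup_set1 G)) -> //.
have [HS nHS] := nH il; have sHi := sH (ltnW il); have Hxi := Hx il.
have sH1 := sH il; have nHi := nH il.
set L := power_subgroup m (H i.+1) in brL.
have sL : is_subgroup L by apply: power_subgroupP.
have L1 : L `<=` H i.+1 by apply: power_subgroup_sub.
(* If the factor is finite, [n]-th powers of elements of [H i] fall into [H i.+1], so [n * m]-th
   powers fall into [L]. *)
have [[n [n0 Hn]]|infx] := pselect (exists n, (0 < n)%N /\ H i.+1 (x i ^+ n)).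
  exists (n * m)%N; split; first by rewrite muln_gt0 n0.
  apply: (bounded_roots_sub _ brL); apply: generated_sub => // _ [y Hy <-].
  rewrite expgnA; apply: power_subgroup_mem.
  have [a ay] := xP il Hy; rewrite -cong1.
  apply: (@cong_trans _ _ _ (zexpg (x i) a ^+ n) _ sH1).
    by rewrite cong1 zexpgX mulrC zexpgM; apply: subgroupZ.
  by apply: (congX sH1 sHi nHi) => //; apply: subgroupZ.
have {}infx a : H i.+1 (zexpg (x i) a) -> a = 0%R.
  case: a => [[|n]|n] // Hn; case: infx; exists n.+1; split=> //.
  by rewrite -[x i ^+ n.+1]invgK; have [_ _ HV] := sH1; apply: HV.
have LJ n h : L n -> H i h -> L (n ^ h).
  move=> Ln Hh; apply: (@power_subgroup_stable _ _ _ (fun y => y ^ h)) => //.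
    by move=> y z; apply: conjMg.
  by move=> y Hy; apply: nHS.
have nL : normal_in L (H i) by split=> [y /L1/HS|].
have [_ HM HV] := sHi.
have [n h Ln Hh|y Hy|s [sH' sP]] := @pc_finite_reps i.+1 L m il sL _ m0.
- by apply: LJ => //; apply: HS.
- exact: power_subgroup_mem.
(* The quotient [H i.+1 / L] is finite, so a power of [x i] centralizes it; [Z] below collects all
   elements that do. *)
have [||y Hy|n [n0 nP]] := @conj_power_cong _ (H i.+1) L s (x i) sL sH1 _ _ _ sH' sP.
- by move=> y Hy; apply: nHS.
- by move=> y Ly; apply: LJ.
- by move=> Ly; rewrite -(conjgK (x i) y); apply: LJ => //; apply: HV.
pose Z := [set g | H i g /\ forall y, H i.+1 y -> cong L y (y ^ g)].
have sZ : is_subgroup Z.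
  split; first by split=> [|y _]; [case: sHi|rewrite conjg1; apply: cong_refl].
    move=> g h [Hg gP] [Hh hP]; split=> [|y Hy]; first exact: HM.
    rewrite conjgM; apply: (cong_trans sL (gP y Hy)); apply: hP; exact: nHS.
  move=> g [Hg gP]; split=> [|y Hy]; first exact: HV.
  have /gP : H i.+1 (y ^ g^-1) by apply: nHS => //; apply: HV.
  by rewrite conjgKV; apply: cong_sym.
have Zx : Z (x i ^+ n) by split=> //; apply: subgroupX.
pose K := [set y | H i y /\ exists a, cong L (zexpg (x i) a) y].
have Hxa a : H i (zexpg (x i) a) by apply: subgroupZ.
have sK : is_subgroup K.
  split; first by split; [case: sHi|exists 0%R; apply: cong_refl].
    move=> y z [Hy [a ay]] [Hz [b bz]]; split; first exact: HM.
    by exists (a + b)%R; rewrite zexpgD; apply: (congM sL nL).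
  move=> y [Hy [a ay]]; split; first exact: HV.
  by exists (- a)%R; rewrite zexpgN; apply: (congV sL sHi nL).
(* Although [H i.+1 / L] may be non-abelian, [z] commutes with it modulo [L], so powers of [z * h]
   split. *)
have powM z h k : Z z -> H i.+1 h -> cong L (z ^+ k * h ^+ k) ((z * h) ^+ k).
  move=> Zz Hh; have [Hz _] := Zz.
  elim: k => [|k IHk]; first by rewrite mulg1; apply: cong_refl.
  have Hzk : H i (z ^+ k) by apply: subgroupX.
  have Hhk : H i (h ^+ k) by apply: HS; apply: subgroupX.
  have zhk : H i ((z * h) ^+ k) by apply: subgroupX => //; apply: HM => //; apply: HS.
  rewrite [(z * h) ^+ _]expgS; apply: (cong_trans sL _ (congMl (z * h) IHk)).
  have -> : z * h * (z ^+ k * h ^+ k) = z ^+ k.+1 * (h ^ (z ^+ k) * h ^+ k).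
    by rewrite /conjg expgS -!mulgA; congr (_ * _); rewrite !mulgA mulgV mul1g.
  rewrite [h ^+ k.+1]expgS; refine (congMl _ _); apply: (congM sL nL) => //.
    by have [_] := @subgroupX _ Z z k sZ Zz; apply.
  exact: cong_refl.
exists (n * m)%N; split; first by rewrite muln_gt0 n0.
apply: (@bounded_roots_sub _ _ K).
  apply: generated_sub => // _ [y Hy <-]; split; first exact: subgroupX.
  (* Here [y ^+ n] is a power [z] of [x i ^+ n] times some [h] in [H i.+1], and [h ^+ m] lies in
     [L]; so [y ^+ (n * m)] is a power of [x i] modulo [L]. *)
  have [a ay] := xP il Hy; exists (Posz n * a * Posz m)%R.
  set z := zexpg (x i ^+ n) a.
  have zy : cong (H i.+1) z (y ^+ n).
    rewrite /z -[x i ^+ n]/(zexpg (x i) (Posz n)) -zexpgM mulrC zexpgM.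
    apply: (congX sH1 sHi nHi) => //.
  have Zz : Z z by apply: subgroupZ.
  have := powM z _ m Zz zy; rewrite mulgA mulgV mul1g -expgnA.
  apply: (cong_trans sL); rewrite !zexpgM -[zexpg (zexpg (x i) (Posz n)) a]/z.
  rewrite -[X in cong _ X]mulg1; refine (congMl _ _); rewrite cong1.
  exact: power_subgroup_mem.
move=> p [Hp [a ap]] p1.
(* The factor is infinite, so the exponent of [x i] modulo [L] is unique and is multiplied by [q]
   under [q]-th powers. A nonzero exponent of [p] bounds [q]; a zero one moves [p] and its roots of
   positive exponent into [L]. *)
have root_exp q w b : cong L (zexpg (x i) b) w -> H i w -> w ^+ q = p ->
    (b * Posz q)%R = a.
  move=> bw Hw wq; apply/eqP; rewrite eq_sym -subr_eq0; apply/eqP/infx.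
  rewrite addrC zexpgD zexpgN; apply: L1; apply: (cong_trans sL _ (cong_sym sL ap)).
  by rewrite -wq -zexpgX; apply: (congX sL sHi nL).
have [a0|a0] := pselect (a = 0%R); last first.
  exists `|a|%N => q w [Hw [b bw]] wq; have := root_exp _ _ _ bw Hw wq.
  move=> bqa; rewrite -bqa abszM leq_pmull // absz_gt0; apply/eqP => b0.
  by apply: a0; rewrite -bqa b0 mul0r.
have Lp : L p by apply/cong1; rewrite -[1]/(zexpg (x i) 0%R) -a0.
have [B BP] := brL p Lp p1; exists B => q w [Hw [b bw]] wq.
have := root_exp _ _ _ bw Hw wq; rewrite a0 => /eqP; rewrite mulf_eq0.
case/orP=> [/eqP b0|/eqP[->]] //; apply: BP wq.
by apply/cong1; rewrite -[1]/(zexpg (x i) 0%R) -b0.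
Qed.

End SeriesRoots.

(** * Ranks, quotients and endomorphisms *)

Section Rank.
Variables (G : groupType) (l : nat) (H : nat -> set G) (x : nat -> G).

Definition infinite_factor (i : nat) : bool :=
  `[< forall n, (0 < n)%N -> ~ H i.+1 (x i ^+ n) >].

Lemma infinite_factorP i :
  infinite_factor i <-> forall n, (0 < n)%N -> ~ H i.+1 (x i ^+ n).
Proof. by split=> [/asboolP|h]; [|apply/asboolP]. Qed.

(** The Hirsch length, read off a chosen series so that a quotient can be compared with the group
    factor by factor. *)
Definition series_rank : nat := #|[pred i : 'I_l | infinite_factor i]|.

End Rank.

Definition torsion_free_elt (G : groupType) (v : G) : Prop :=
  forall n, (0 < n)%N -> v ^+ n <> 1.

Section QuotientSeries.
Variables (G K : groupType) (f : G -> K).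
Hypotheses (fM : {morph f : x y / x * y}) (f_surj : forall z, exists y, f y = z).
Variables (l : nat) (H : nat -> set G) (x : nat -> G).
Hypothesis pcH : pc_series l H x.

Lemma pc_series_image : pc_series l (fun i => f @` H i) (fun i => f (x i)).
Proof.
have [H0 Hl sH nH xP] := pcH; split.
- by rewrite eqEsubset; split=> // z _; have [y <-] := f_surj z; exists y; rewrite ?H0.
- by rewrite Hl image_set1 (morphg1 fM).
- by move=> i il; apply: subgroup_image => //; apply: sH.
- move=> i il; have [HS nHS] := nH i il; split; first exact: image_subset.
  move=> _ _ [n Hn <-] [h Hh <-]; exists (n ^ h); first exact: nHS.
  by rewrite (morphgJ fM).
- move=> i il; have [Hx xP'] := xP i il; split; first by exists (x i).
  move=> _ [y Hy <-]; have [a ay] := xP' y Hy; exists a.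
  by rewrite /cong -(morph_zexpg fM) -(morphgV fM) -fM; exists ((zexpg (x i) a)^-1 * y).
Qed.

(** Take the last [i] such that [H i] contains a positive power of [v]. That power has infinite
    order in factor [i], and killing it makes the factor finite; finite factors stay finite. *)
Lemma series_rank_image v : torsion_free_elt v -> f v = 1 ->
  (series_rank l (fun i => f @` H i) (fun i => f (x i)) < series_rank l H x)%N.
Proof.
move=> tfv fv; have [H0 Hl sH nH xP] := pcH.
have [i [il [n n0 Hn] maxi]] : exists i, [/\ (i < l)%N,
    exists2 n, (0 < n)%N & H i (v ^+ n) &
    forall n, (0 < n)%N -> ~ H i.+1 (v ^+ n)].
  apply: contrapT => nex.
  have [n n0] : exists2 n, (0 < n)%N & H l (v ^+ n).
    suff: forall i, (i <= l)%N -> exists2 n, (0 < n)%N & H i (v ^+ n) by apply.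
    elim=> [_|i IHi il]; first by exists 1%N; rewrite ?H0.
    apply: contrapT => nH1; apply: nex; exists i; split=> // [|n n0 Hn].
      by apply: IHi; apply: ltnW.
    by apply: nH1; exists n.
  by rewrite Hl; apply: tfv.
have sH1 := sH _ il; have sHi := sH _ (ltnW il); have nHi := nH _ il.
have [Hx xP'] := xP _ il; have [a ay] := xP' _ Hn.
have a0 : a <> 0%R.
  by move=> a0; apply: (maxi n n0); apply/cong1; rewrite -[1]/(zexpg (x i) 0%R) -a0.
apply/proper_card/properP; split.
  apply/fintype.subsetP => j; rewrite /in_mem /= => /infinite_factorP infj.
  apply/infinite_factorP => k k0 Hk.
  by apply: (infj k k0); exists (x j ^+ k); rewrite ?(morphgX fM).
exists (Ordinal il); rewrite /in_mem /=.
  apply/infinite_factorP => k k0 Hk; apply: (maxi (n * k)%N); first by rewrite muln_gt0 n0.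
  apply/cong1; apply: (@cong_trans _ _ _ (zexpg (x i) a ^+ k) _ sH1).
    by apply/cong1; rewrite zexpgX mulrC zexpgM; apply: subgroupZ.
  by rewrite expgnA; apply: (congX sH1 sHi nHi) => //; apply: subgroupZ.
apply/negP => /infinite_factorP inf'.
have fxa : f (zexpg (x i) a) = f ((zexpg (x i) a)^-1 * v ^+ n)^-1.
  by rewrite invgM invgK fM (morphgV fM) (morphgX fM) fv expg1n invg1 mul1g.
have [_ _ HV] := sH1; have := HV _ ay => ay'.
case: a a0 ay fxa ay' => [[//|k]|k] _ ay fxa ay'; apply: (inf' k.+1) => //.
  by rewrite -(morphgX fM); exists ((zexpg (x i) (Posz k.+1))^-1 * v ^+ n)^-1.
rewrite -(morphgX fM) -[x i ^+ k.+1]invgK (morphgV fM); rewrite /= in fxa.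
rewrite fxa -(morphgV fM) invgK; exists ((zexpg (x i) (Negz k))^-1 * v ^+ n) => //.
Qed.

End QuotientSeries.

Section Derived.
Variable G : groupType.

Definition derived (S : set G) : set G :=
  generated [set z | exists u v, [/\ S u, S v & z = [~ u, v]]].

Lemma derived_stable S (f : G -> G) : {morph f : x y / x * y} ->
  (forall y, S y -> S (f y)) -> forall y, derived S y -> derived S (f y).
Proof.
move=> fM Sf; apply: generated_stable => // _ [u [v [Su Sv ->]]].
apply: sub_generated; exists (f u), (f v); split; [exact: Sf|exact: Sf|].
by rewrite /commg fM (morphgV fM) (morphgJ fM).
Qed.

Lemma derived_sub S : is_subgroup S -> derived S `<=` S.
Proof.
move=> sS; have [_ SM SV] := sS; apply: generated_sub => // _ [u [v [Su Sv ->]]].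
by apply: (SM); [exact: SV|apply: (SM); [exact: SV|exact: SM]].
Qed.

Variables (l : nat) (H : nat -> set G) (x : nat -> G).
Hypothesis pcH : pc_series l H x.

Lemma derived_series S i : (i < l)%N -> S `<=` H i -> derived S `<=` H i.+1.
Proof.
move=> il SH; have [H0 Hl sH nH xP] := pcH.
have sH1 := sH _ il; have sHi := sH _ (ltnW il); have nHi := nH _ il.
have [_ HM HV] := sHi; have [Hx xP'] := xP _ il.
apply: generated_sub => // _ [u [v [/SH Hu /SH Hv ->]]].
have [a au] := xP' u Hu; have [b bv] := xP' v Hv.
have uv : cong (H i.+1) (zexpg (x i) a * zexpg (x i) b) (u * v).
  by apply: (congM sH1 nHi) => //; apply: subgroupZ.
have vu : cong (H i.+1) (zexpg (x i) b * zexpg (x i) a) (v * u).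
  by apply: (congM sH1 nHi) => //; apply: subgroupZ.
have := cong_trans sH1 (cong_sym sH1 vu); rewrite zexpg_commute => /(_ _ uv).
by rewrite /cong /commg /conjg invgM !mulgA.
Qed.

Lemma iter_derived_trivial S : iter l derived S `<=` [set 1].
Proof.
have [H0 Hl sH nH xP] := pcH; rewrite -Hl.
suff: forall i, (i <= l)%N -> iter i derived S `<=` H i by apply.
elim=> [_|i IHi il]; first by rewrite H0.
by apply: derived_series => //; apply: IHi; apply: ltnW.
Qed.

End Derived.

Lemma expg_commute_closed (G : groupType) (V : set G) (m : nat) :
  is_subgroup V -> (forall u v, V u -> V v -> commute u v) ->
  is_subgroup [set u ^+ m | u in V].
Proof.
move=> [V1 VM VV] cV; split; first by exists 1; rewrite ?expg1n.
  move=> _ _ [u Vu <-] [v Vv <-]; exists (u * v); first exact: VM.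
  by rewrite expgMn //; apply: cV.
by move=> _ [u Vu <-]; exists u^-1; [exact: VV|rewrite expVgn].
Qed.

Section AbelianEndomorphism.
Variables (G : groupType) (l : nat) (H : nat -> set G) (x : nat -> G).
Hypothesis pcH : pc_series l H x.
Variables (phi : G -> G) (V : set G).
Hypotheses (phiM : {morph phi : x y / x * y}) (phi_inj : injective phi).
Hypotheses (sV : is_subgroup V) (cV : forall u v, V u -> V v -> commute u v).
Hypothesis phiV : forall v, V v -> V (phi v).

(* By noetherianity some [phi^k v] lies in the span of the previous iterates of
   [v]; cancelling the lowest powers of the injective [phi] in such a relation
   puts a power of [v] in the image. *)
Lemma expg_mem_image v : V v -> exists2 d, (0 < d)%N & (phi @` V) (v ^+ d).
Proof.
move=> Vv; have [V1 VM VV] := sV.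
(* [C k] is the span of the first [k] iterates of [v], in Horner form: an element is [v^a] times the
   image under [phi] of an element of the previous span. *)
pose fix C k : set G := if k is j.+1 then
  [set zexpg v p.1 * phi p.2 | p in [set p : int * G | C j p.2]] else [set 1].
have Vz a : V (zexpg v a) by apply: subgroupZ.
have CV k : C k `<=` V.
  elim: k => [|k IHk] w /=; first by move=> ->.
  by move=> [[a c] /= /IHk Vc <-]; apply: VM => //; apply: phiV.
have sC k : is_subgroup (C k).
  elim: k => [|k [C1 CM CV']]; first exact: subgroup_set1.
  split=> /=.
  - by exists (0%R, 1); rewrite //= mul1g (morphg1 phiM).
  - move=> _ _ [[a c] /= Cc <-] [[b d] /= Cd <-]; exists ((a + b)%R, c * d).
      exact: CM.
    rewrite /= zexpgD phiM !mulgA; congr (_ * _); rewrite -!mulgA; congr (_ * _).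
    by apply: cV => //; apply/phiV/(CV k).
  - move=> _ [[a c] /= Cc <-]; exists ((- a)%R, c^-1); first exact: CV'.
    rewrite /= zexpgN (morphgV phiM) -invgM; congr _^-1.
    by apply: cV => //; apply/phiV/(CV k).
have CS k : C k `<=` C k.+1.
  elim: k => [|k IHk] w /=.
    by move=> ->; exists (0%R, 1); rewrite //= mul1g (morphg1 phiM).
  by move=> [[a c] /= Cc <-]; exists (a, c) => //=; apply: IHk.
have Cphi k : C k.+1 (iter k phi v).
  elim: k => [|k IHk]; first by exists (1%R, 1); rewrite //= (morphg1 phiM) mulg1.
  by exists (0%R, iter k phi v); rewrite //= mul1g.
have Vphi k : V (iter k phi v) by elim: k => // k IHk; apply: phiV.
have [k /(_ _ (Cphi k))] := pc_acc pcH sC CS.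
elim: k => [/= ->|k IHk [[a c] /= Cc avE]].
  by exists 1%N => //; exists 1 => //; rewrite (morphg1 phiM).
have [a0|a0] := pselect (a = 0%R).
  by apply: IHk; move: avE; rewrite a0 mul1g => /phi_inj <-.
have av : (phi @` V) (zexpg v a).
  exists (iter k phi v * c^-1); first by apply: VM => //; apply: VV; apply: (CV k).
  by rewrite phiM (morphgV phiM) -avE mulgK.
case: a a0 av {avE} => [[//|n]|n] _ av; exists n.+1 => //.
have [_ _ h] := subgroup_image phiM sV.
by rewrite -[v ^+ n.+1]invgK; apply: h.
Qed.

(** [V] is abelian and finitely generated, so the product of the exponents found for its generators
    serves every element. *)
Lemma expg_mem_image_uniform :
  exists2 d, (0 < d)%N & forall v, V v -> (phi @` V) (v ^+ d).
Proof.
have [s [sV' sP]] := pc_fg pcH sV.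
have sI := subgroup_image phiM sV; have [V1 VM VV] := sV.
have [d d0 dP] : exists2 d, (0 < d)%N & forall u, u \in s -> (phi @` V) (u ^+ d).
  elim: s sV' {sP} => [|u s IHs] sV'; first by exists 1%N.
  have [|d d0 dP] := IHs; first by move=> w ws; apply: sV'; rewrite inE ws orbT.
  have [e e0 eP] := expg_mem_image (sV' u (mem_head u s)).
  exists (d * e)%N; first by rewrite muln_gt0 d0.
  move=> w; rewrite inE => /predU1P[->|ws]; last first.
    by rewrite expgnA; apply: subgroupX => //; apply: dP.
  by rewrite mulnC expgnA; apply: subgroupX.
exists d => // v Vv.
have sD : is_subgroup [set v | V v /\ (phi @` V) (v ^+ d)].
  have [I1 IM IV] := sI; split; first by split=> //; rewrite expg1n.
    move=> u w [Vu Iu] [Vw Iw]; split; first exact: VM.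
    by rewrite expgMn; [exact: IM|exact: cV].
  by move=> u [Vu Iu]; split; [exact: VV|rewrite expVgn; exact: IV].
by have [] := sP _ sD (fun u us => conj (sV' u us) (dP u us)) v Vv.
Qed.

End AbelianEndomorphism.

(** * Saturated normal subgroups separating an element from 1 *)

Section InvariantSeparation.
Implicit Types G : groupType.

Lemma iter_morph G (phi : G -> G) k :
  {morph phi : x y / x * y} -> {morph iter k phi : x y / x * y}.
Proof. by move=> phiM x y; elim: k => //= k ->; rewrite phiM. Qed.

Lemma iter_inj G (phi : G -> G) k : injective phi -> injective (iter k phi).
Proof. by move=> phiI x y; elim: k => //= k IHk /phiI. Qed.

(** Since [phi] maps [S] into itself, the preimages of [S] under the iterates of [phi] increase,
    hence become stationary; the stationary one equals its own preimage. *)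
Lemma saturated_preimage G l (H : nat -> set G) (x : nat -> G) (phi : G -> G) (S : set G) :
  pc_series l H x -> {morph phi : x y / x * y} -> is_subgroup S ->
  (forall y, S y -> S (phi y)) ->
  exists k, forall y, S (iter k phi (phi y)) <-> S (iter k phi y).
Proof.
move=> pcH phiM sS phiS.
have [||k kP] := pc_acc (C := fun k => iter k phi @^-1` S) pcH.
- by move=> k; apply: subgroup_preimage => //; apply: iter_morph.
- by move=> k y; apply: phiS.
exists k => y; rewrite -iterSr; split; [exact: (kP y)|exact: phiS].
Qed.

(** Finite index is encoded as finite exponent of the quotient, which pulls back along morphisms
    directly; [pc_finite_reps] converts it. *)
Definition invariant_separation G (phi : G -> G) (p : G) (M : set G) : Prop :=
  [/\ is_subgroup M, normal_in M [set: G], (forall y, M (phi y) <-> M y), ~ M p &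
      exists2 m, (0 < m)%N & forall y, M (y ^+ m)].

Lemma invariant_separation_quotient G (phi : G -> G) (p : G)
    (U : normal_subgroup G) (psi : quotient_group U -> quotient_group U)
    (M : set (quotient_group U)) :
  (forall y, psi (\pi_(quotient_group U) y) = \pi_(quotient_group U) (phi y)) ->
  invariant_separation psi (\pi_(quotient_group U) p) M ->
  invariant_separation phi p (\pi_(quotient_group U) @^-1` M).
Proof.
move=> psiE [sM nM psiM Mp [m m0 mP]].
have piM : {morph \pi_(quotient_group U) : y z / y * z} by apply: piMg.
split=> //.
- exact: subgroup_preimage.
- split=> // n h Mn _; rewrite /preimage /= (morphgJ piM).
  exact: (nM.2 _ _ Mn I).
- by move=> y; rewrite /preimage /= -psiE; apply: psiM.
- by exists m => // y; rewrite /preimage /= (morphgX piM); apply: mP.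
Qed.

Lemma polycyclic_invariant_separation G (phi : G -> G) (p : G) :
  polycyclic G -> {morph phi : x y / x * y} -> injective phi -> p <> 1 ->
  exists M, invariant_separation phi p M.
Proof.
move=> /polycyclic_series[l [H [x pcH]]].
have [r] := ubnP (series_rank l H x).
elim: r G phi p H x pcH => // r IHr G phi p H x pcH; rewrite ltnS => rank_le.
move=> phiM phiI p1.
have [m [m0 brL]] := pc_bounded_roots pcH (leq0n l).
have H0 : H 0%N = setT by case: pcH.
rewrite H0 in brL; set L := power_subgroup m [set: G] in brL.
have sL : is_subgroup L by apply: power_subgroupP.
have phiL y : L y -> L (phi y) by apply: power_subgroup_stable.
have [k kP] := saturated_preimage pcH phiM sL phiL.
have phikM := iter_morph k phiM; have phikI := @iter_inj _ _ k phiI.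
pose K := iter k phi @^-1` L.
have sK : is_subgroup K by apply: subgroup_preimage.
have LJ y h : L y -> L (y ^ h).
  by apply: (power_subgroup_stable (f := fun y => y ^ h)) => // ? ?; apply: conjMg.
have KJ y h : K y -> K (y ^ h).
  by rewrite /K /preimage /= (morphgJ phikM); apply: LJ.
(* The injective map [iter k phi] carries roots in [K] to roots in [L]. *)
have brK : bounded_roots K.
  move=> q Kq q1; have [|B BP] := brL _ Kq.
    by rewrite -(morphg1 phikM) => /phikI.
  by exists B => n w Kw wn; apply: (BP _ _ Kw); rewrite -(morphgX phikM) wn.
have Km y : K (y ^+ m).
  by rewrite /K /preimage /= (morphgX phikM); apply: power_subgroup_mem.
have [Kp|nKp] := pselect (K p); last first.
  by exists K; split=> //; [split=> // y h + _; apply: KJ|exists m].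
(* If [v ^+ n = 1], then [v] is its own root of exponent [(n * B.+1).+1], which exceeds [B]. *)
have Ktf v : K v -> v <> 1 -> torsion_free_elt v.
  move=> Kv v1 n n0 vn; have [B BP] := brK v Kv v1.
  have := BP (n * B.+1).+1 v Kv; rewrite expgS expgnA vn expg1n mulg1.
  by move=> /(_ erefl); nia.
pose D i := iter i (@derived G) K.
have sD i : is_subgroup (D i) by case: i => // i; apply: generated_subgroup.
have Dstable (f : G -> G) : {morph f : x y / x * y} ->
    (forall y, K y -> K (f y)) -> forall i y, D i y -> D i (f y).
  by move=> fM fK; elim=> [|i IHi] // y; apply: derived_stable.
have DK i : D i `<=` K.
  by elim: i => // i IHi; apply: (subset_trans _ IHi); apply: derived_sub.
(* The derived series of [K] reaches 1 within [l] steps, while [K] itself contains [p]. *)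
have [i [[w Dw w1] Di1]] : exists i, (exists2 w, D i w & w <> 1) /\
    D i.+1 `<=` [set 1].
  apply: contrapT => nex.
  have := iter_derived_trivial pcH (S := K); rewrite -/(D l).
  elim: (l) => [D1|i IHi D1]; first by apply: p1; apply: D1.
  apply: IHi => w Dw; apply: contrapT => w1; apply: nex; exists i; split=> //.
  by exists w.
pose W := D i.
have phiK y : K y -> K (phi y) by rewrite /K /preimage /= => /kP.
have phiW y : W y -> W (phi y) by apply: Dstable.
have WJ y h : W y -> W (y ^ h).
  by apply: (Dstable (fun y => y ^ h)) => [? ?|z]; [exact: conjMg|exact: KJ].
have cW u v : W u -> W v -> commute u v.
  by move=> Wu Wv; apply/commgP/eqP/Di1; apply: sub_generated; exists u, v.
have [n nP] := saturated_preimage pcH phiM (sD i) phiW.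
have phinM := iter_morph n phiM; have phinI := @iter_inj _ _ n phiI.
pose V := iter n phi @^-1` W.
have sV : is_subgroup V by exact: (subgroup_preimage phinM (sD i)).
have VJ y h : V y -> V (y ^ h).
  by rewrite /V /preimage /= (morphgJ phinM); apply: WJ.
have cV u v : V u -> V v -> commute u v.
  by move=> Vu Vv; apply: phinI; rewrite !phinM; apply: cW.
have phiV y : V (phi y) <-> V y by apply: nP.
(* As [K] equals its preimage under [phi], saturating a subgroup of [K] does not leave [K]. *)
have VK : V `<=` K.
  move=> y /DK; elim: (n) => // j IHj /=; rewrite /K /preimage /= => h.
  by apply: IHj; apply/kP.
have WV : W `<=` V.
  by move=> y; rewrite /V /preimage /=; elim: (n) => // j IHj /IHj; apply: phiW.
(* By induction, as G / U has smaller rank than G. *)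
suff [U [sU UJ phiU nUp [[u Uu u1] UK]]] : exists U, [/\ is_subgroup U,
    (forall y h, U y -> U (y ^ h)), (forall y, U (phi y) <-> U y), ~ U p &
    (exists2 u, U u & u <> 1) /\ U `<=` K].
  have nU : normal_in U [set: G] by split=> // y h + _; apply: UJ.
  pose Q := NormalSubgroup sU nU; pose pi : G -> quotient_group Q := \pi.
  have piM : {morph pi : y z / y * z} by apply: piMg.
  have pi_surj z : exists y, pi y = z by exists (repr z); apply: reprK.
  (* One direction of [phiU] makes this independent of representatives, the other makes it
     injective. *)
  pose psi (z : quotient_group Q) : quotient_group Q := pi (phi (repr z)).
  have psiE y : psi (pi y) = pi (phi y).
    apply/coset_piP; rewrite -(morphgV phiM) -phiM; apply/phiU.
    by apply/(@coset_piP _ Q); rewrite reprK.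
  have [||||M MP] := IHr (quotient_group Q) psi (pi p) _ _
    (pc_series_image piM pi_surj pcH).
  - apply: leq_trans rank_le; apply: (series_rank_image piM pcH (v := u)).
      by apply: Ktf => //; apply: UK.
    have <- : pi 1 = 1 by apply: morphg1.
    apply/esym/coset_piP; rewrite invg1 mul1g; exact: Uu.
  - move=> y z; have [y' <-] := pi_surj y; have [z' <-] := pi_surj z.
    by rewrite -piM !psiE phiM piM.
  - move=> y z; have [y' <-] := pi_surj y; have [z' <-] := pi_surj z.
    rewrite !psiE => /coset_piP; rewrite -(morphgV phiM) -phiM => /phiU h.
    exact/coset_piP.
  - rewrite -(morphg1 piM) => /esym/coset_piP.
    by rewrite invg1 mul1g.
  by exists (pi @^-1` M); apply: invariant_separation_quotient MP.
have [Vp|nVp] := pselect (V p); last first.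
  by exists V; split=> //; split=> //; exists w => //; apply: WV.
have [d d0 dP] := expg_mem_image_uniform pcH phiM phiI sV cV (fun v => (phiV v).2).
have [B BP] := brK p Kp p1; have B0 : (0 < B)%N by apply: (BP 1%N p).
pose q := (d * B).+1.
have UV : [set v ^+ q | v in V] `<=` V.
  by move=> _ [v Vv <-]; apply: subgroupX.
exists [set v ^+ q | v in V]; split.
- exact: expg_commute_closed.
- by move=> _ h [v Vv <-]; exists (v ^ h); [apply: VJ|rewrite conjXg].
- move=> y; split=> [Uy|[v Vv <-]]; last first.
    by exists (phi v); [apply/phiV|rewrite (morphgX phiM)].
  have Vy : V y by apply/phiV/UV.
  have [v Vv vy] := Uy; have [u Vu uv] := dP v Vv.
  have yu : y ^+ d = u ^+ q.
    by apply: phiI; rewrite !(morphgX phiM) -vy uv -!expgnA mulnC.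
  have [_ VM VN] := sV.
  have VuB : V (u ^+ B)^-1 by apply: VN; apply: subgroupX.
  (* Since [q - d * B = 1] and [y ^+ d = u ^+ q], the element [y = y ^+ q * (y ^+ d) ^- B] is a
     [q]-th power. *)
  exists (y * (u ^+ B)^-1); first exact: VM.
  rewrite expgMn; last exact: cV.
  by rewrite expVgn -expgnA mulnC expgnA -yu -expgnA /q expgS mulgK.
(* As [d] is positive, [q] exceeds the bound [B] on the exponents of roots of [p] in [K]. *)
- by move=> [v Vv vq]; have := BP q v (VK _ Vv) vq; rewrite /q; nia.
- split; last exact: (subset_trans UV).
  by exists (p ^+ q); [exists p|apply: (Ktf p Kp p1)].
Qed.

End InvariantSeparation.

(** * Ascending extensions of polycyclic groups are residually finite *)

Lemma finite_index_reps (G : groupType) (K : set G) (s : seq G) :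
  is_subgroup K -> normal_in K [set: G] ->
  (forall y, exists2 r, r \in s & cong K r y) ->
  exists N : finite_index_normal G, normal_set N = K.
Proof.
move=> sK nK sP; pose Q := NormalSubgroup sK nK.
have fQ : finite_set [set: quotient_group Q].
  apply: (@sub_finite_set _ _ [set (\pi_(quotient_group Q) r) | r in [set` s]]).
    move=> z _; have [r rs rz] := sP (repr z); exists r => //.
    by rewrite -[z]reprK; apply/coset_piP.
  exact: finite_image (finite_seq s).
by exists (FiniteIndexNormal fQ).
Qed.

(** Both sides say that the commutator of [z] and [h] lies in [N]; this exchanges the element that
    acts with the one acted upon. *)
Lemma cong_conjC (G : groupType) (N : set G) z h :
  cong N z (z ^ h) = cong N (h ^ z) h.
Proof. by rewrite /cong /conjg !invgM invgK !mulgA. Qed.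

(** Stated inside the ambient group, so that series can be pushed and pulled along morphisms without
    changing types. *)
Definition polycyclic_set (E : groupType) (X : set E) : Prop :=
  exists (n : nat) (H : nat -> set E),
    [/\ H 0%N = X, H n = [set 1], (forall i, (i <= n)%N -> is_subgroup (H i)) &
        (forall i, (i < n)%N ->
           normal_in (H i.+1) (H i) /\ cyclic_factor (H i) (H i.+1))].

Section SubgroupType.
Variables (E : groupType) (H : set E).
Hypothesis sH : is_subgroup H.

(** The dummy [sH] records the subgroup property in the type, from which the group structure is
    inferred. *)
Definition subgroup_type : Type := let _ := sH in set_type H.

HB.instance Definition _ := SubType.on subgroup_type.
HB.instance Definition _ := Choice.on subgroup_type.

Lemma subgroup_type_closed : group_closed (mem H).
Proof.
have [H1 HM HV] := sH; split=> [|x y]; rewrite !inE //.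
by move=> Hx Hy; apply: HM => //; apply: HV.
Qed.

HB.instance Definition _ :=
  SubChoice_isSubGroup.Build E (mem H) subgroup_type subgroup_type_closed.

Lemma subgroup_valM : {morph (val : subgroup_type -> E) : x y / x * y}.
Proof. exact: valM. Qed.

Lemma subgroup_valP (x : subgroup_type) : H (val x).
Proof. by have := valP x; rewrite inE. Qed.

Lemma subgroup_val_ex x : H x -> exists y : subgroup_type, val y = x.
Proof. by move=> Hx; exists (exist _ x (mem_set Hx)). Qed.

Lemma polycyclic_subgroup_type : polycyclic_set H -> polycyclic subgroup_type.
Proof.
move=> [n [F [F0 Fn sF cF]]]; have vM := subgroup_valM.
have vX (x : subgroup_type) k : val (x ^+ k) = val x ^+ k by apply: morphgX.
have vV (x : subgroup_type) : val x^-1 = (val x)^-1 by apply: morphgV.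
have FH i : (i <= n)%N -> F i `<=` H.
  elim: i => [|i IHi] il; first by rewrite F0.
  by apply: (subset_trans _ (IHi (ltnW il))); have [[]] := cF i il.
exists n, (fun i => (val : subgroup_type -> E) @^-1` F i); split.
- by rewrite F0 eqEsubset; split=> // x _; apply: subgroup_valP.
- rewrite Fn eqEsubset; split=> x; rewrite /preimage /=.
    by move=> x1; apply: val_inj; rewrite (morphg1 vM); exact: x1.
  by move=> ->; apply: (morphg1 vM).
- by move=> i il; apply: subgroup_preimage => //; apply: sF.
- move=> i il; have [[FS nF] [x Fx xP]] := cF i il; split.
    split=> [y|y h]; first exact: FS.
    by rewrite /preimage /mkset (morphgJ vM) ; apply: nF.
  have [x' x'E] := subgroup_val_ex (FH _ (ltnW il) _ Fx).
  exists x'; first by rewrite /preimage /= x'E.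
  move=> y /xP[k kP]; exists k; rewrite /preimage /mkset.
  by rewrite !vM vV vX x'E.
Qed.

End SubgroupType.

(** * A polycyclic base [H], a stable letter [t] and a height map [psi] to the integers *)

Section ResidualFiniteness.
Variables (E : groupType) (H : set E) (t : E) (psi : E -> int).
Hypotheses (sH : is_subgroup H) (pH : polycyclic_set H).
Hypothesis Ht : forall h, H h -> H (h ^ t).
Hypothesis psiM : forall x y, psi (x * y) = (psi x + psi y)%R.
Hypotheses (psiH : forall h, H h -> psi h = 0%R) (psit : psi t = 1%R).
Hypothesis kerP : forall e, psi e = 0%R -> exists k, H (e ^ (t ^+ k)).

Let psi1 : psi 1 = 0%R.
Proof. by apply: (addrI (psi 1)); rewrite -psiM mulg1 addr0. Qed.

Let psiV x : psi x^-1 = (- psi x)%R.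
Proof. by apply: (addrI (psi x)); rewrite -psiM mulgV psi1 subrr. Qed.

Let psiJ x y : psi (x ^ y) = psi x.
Proof. by rewrite /conjg !psiM psiV [(psi x + _)%R]addrC addKr. Qed.

Let psiZ x a : psi (zexpg x a) = (a * psi x)%R.
Proof.
have psiX n : psi (x ^+ n) = (Posz n * psi x)%R.
  by elim: n => [|n IHn]; rewrite ?mul0r // expgS psiM IHn; lia.
by case: a => n /=; rewrite ?psiV psiX //; lia.
Qed.

Let zexpt_ker e : psi ((zexpg t (psi e))^-1 * e) = 0%R.
Proof. by rewrite psiM psiV psiZ psit mulr1 addNr. Qed.

Lemma separate_outside_kernel e :
  psi e <> 0%R -> exists N : finite_index_normal E, ~ normal_set N e.
Proof.
(* A modulus larger than the nonzero height of [e] cannot divide it. *)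
move=> e0; pose n := `|psi e|%N.+1.
pose K : set E := [set x | (Posz n %| psi x)%Z].
have sK : is_subgroup K.
  rewrite /K; split=> [|x y|x] /=; first by rewrite psi1 dvdz0.
    by rewrite psiM; apply: rpredD.
  by rewrite psiV rpredN.
have nK : normal_in K [set: E] by split=> // x y; rewrite /K /= psiJ.
have [y|N NK] := @finite_index_reps _ K [seq t ^+ i | i <- iota 0 n] sK nK.
  exists (t ^+ `|(psi y %% Posz n)%Z|%N).
    apply: map_f; rewrite mem_iota /= add0n -ltz_nat gez0_abs ?modz_ge0 //.
    exact: ltz_pmod.
  rewrite /cong /K /= psiM psiV.
  have -> : psi (t ^+ `|(psi y %% Posz n)%Z|%N) = (psi y %% Posz n)%Z.
    rewrite -[t ^+ _]/(zexpg t (Posz `|(psi y %% Posz n)%Z|%N)) psiZ psit mulr1.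
    by rewrite gez0_abs ?modz_ge0.
  have -> : (- (psi y %% Posz n)%Z + psi y)%R = ((psi y %/ Posz n)%Z * Posz n)%R.
    by have := divz_eq (psi y) (Posz n); lia.
  exact: dvdz_mull.
exists N; rewrite NK /K /= => /dvdzP[q qe].
have := congr1 absz qe; rewrite abszM /=; case: (posnP `|q|%N) => [|q0].
  by move=> /eqP; rewrite absz_eq0 => /eqP q0; case: e0; rewrite qe q0 mul0r.
by rewrite /n; nia.
Qed.

Section Kernel.
Variable M : set E.
Hypotheses (sM : is_subgroup M) (MH : M `<=` H).
Hypothesis MJ : forall x h, M x -> H h -> M (x ^ h).
Hypothesis Mt : forall h, H h -> M (h ^ t) <-> M h.
Variable s : seq E.
Hypothesis Hs : forall r, r \in s -> H r.
Hypothesis sP : forall h, H h -> exists2 r, r \in s & cong M r h.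

Let HtX k h : H h -> H (h ^ (t ^+ k)).
Proof.
elim: k h => [|k IHk] h Hh; rewrite ?conjg1 // expgS conjgM.
by apply: IHk; apply: Ht.
Qed.

Let MtX k h : H h -> M (h ^ (t ^+ k)) <-> M h.
Proof.
elim: k h => [|k IHk] h Hh; rewrite ?conjg1 // expgS conjgM.
by rewrite IHk ?Mt //; apply: Ht.
Qed.

(** The ascending union of the conjugates of [M] by negative powers of [t]. *)
Let L : set E := [set x | exists k, M (x ^ (t ^+ k))].

Let Lshift x k n : M (x ^ (t ^+ k)) -> M (x ^ (t ^+ (k + n))).
Proof. by move=> Mx; rewrite expgnDr conjgM; apply/MtX => //; apply: MH. Qed.

Let sL : is_subgroup L.
Proof.
have [M1 MM MV] := sM; split.
- by exists 0%N; rewrite conjg1.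
- move=> x y [k kx] [n ny]; exists (k + n)%N; rewrite conjMg; apply: MM.
    exact: Lshift.
  by rewrite addnC; apply: Lshift.
- by move=> x [k kx]; exists k; rewrite conjVg; apply: MV.
Qed.

(** Here saturation counts: passing to the union adds no element of [H]. *)
Let LH h : H h -> L h -> M h.
Proof. by move=> Hh [k /MtX]; apply. Qed.

Let ML : M `<=` L.
Proof. by move=> x Mx; exists 0%N; rewrite conjg1. Qed.

Let psiL x : L x -> psi x = 0%R.
Proof. by move=> [k /MH/psiH]; rewrite psiJ. Qed.

Let Lt x : L (x ^ t) <-> L x.
Proof.
split=> [[k kx]|[k kx]]; first by exists k.+1; rewrite expgS conjgM.
by exists k; rewrite -conjgM -expgS; have := Lshift 1 kx; rewrite addn1.
Qed.

(** [e] is a power of [t] times an element of height 0; one common power of [t] brings the latter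
    into [H] and the conjugate of [x] into [M], where [MJ] applies. *)
Let LJ x e : L x -> L (x ^ e).
Proof.
move=> Lx; rewrite -[e](mulVKg (zexpg t (psi e))) conjgM.
have : L (x ^ zexpg t (psi e)).
  case: (psi e) => n /=; elim: n x Lx => [|n IHn] x Lx.
  - by rewrite conjg1.
  - by rewrite expgS conjgM; apply/IHn/Lt.
  - by rewrite expg1; apply/Lt; rewrite conjgKV.
  - by rewrite expgSr invgM conjgM; apply: IHn; apply/Lt; rewrite conjgKV.
have [n nk] := kerP (zexpt_ker e); move: (_^-1 * e) nk => h Hh.
move: (x ^ _) => y [k ky]; exists (k + n)%N.
rewrite conjJg; apply: MJ; first exact: Lshift.
by rewrite addnC expgnDr conjgM; apply: HtX.
Qed.

Let nL : normal_in L [set: E]. Proof. by split=> // x e Lx _; apply: LJ. Qed.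

Let repsL e : psi e = 0%R -> exists2 r, r \in s & cong L r e.
Proof.
have [n [n0 nP]] := @conj_power_cong _ H M s t sM sH Ht
  (fun y My => (Mt (MH My)).2 My) (fun y Hy => (Mt Hy).1) Hs sP.
move=> /kerP[k]; elim: k e => [|k IHk] e.
  by rewrite conjg1 => /sP[r rs re]; exists r => //; apply: ML.
rewrite expgS conjgM => /IHk[r rs re]; have Hr := Hs rs.
(* As [t ^+ n] acts trivially on [H / M], conjugation by [t ^+ n.-1] undoes conjugation by [t]
   modulo [M]. *)
have [r' r's rr'] := sP (HtX n.-1 Hr); exists r' => //.
apply: (cong_trans sL (ML rr')); rewrite /cong; apply/Lt.
rewrite conjMg conjVg -conjgM -expgSr prednK //.
by apply: (cong_trans sL _ re); apply/(cong_sym sL)/ML/nP.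
Qed.

(** Some [t ^+ n] centralizes the finite quotient of the kernel of [psi] by [L]. With [L] it forms a
    normal subgroup [K] of finite index, and by heights an element of [H] in [K] lies in [L], hence
    in [M]. *)
Lemma separate_in_kernel : exists N : finite_index_normal E,
  forall h, H h -> normal_set N h -> M h.
Proof.
pose ker : set E := [set e | psi e = 0%R].
have sker : is_subgroup ker.
  split=> [|x y|x]; rewrite /ker /= ?psi1 // ?psiM ?psiV => ->.
    by rewrite add0r.
  by rewrite oppr0.
have kerJ x e : ker x -> ker (x ^ e) by rewrite /ker /= psiJ.
have ker_s r : r \in s -> ker r by move=> /Hs/psiH.
have [|||n [n0 nP]] := @conj_power_cong _ ker L s t sL sker _ _ _ ker_s repsL.
- by move=> y; apply: kerJ.
- by move=> y /Lt.
- by move=> y _ /Lt.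
pose Z := [set g | forall y, ker y -> cong L y (y ^ g)].
have sZ : is_subgroup Z.
  split=> [y _|g h gP hP y Ky|g gP y Ky].
  - by rewrite conjg1; apply: cong_refl.
  - by rewrite conjgM; apply: (cong_trans sL (gP y Ky)); apply/hP/kerJ.
  - by have := gP _ (kerJ _ g^-1 Ky); rewrite conjgKV => /(cong_sym sL).
pose K : set E := [set x | exists a, cong L (zexpg (t ^+ n) a) x].
have sK : is_subgroup K.
  split; first by exists 0%R; apply: cong_refl.
    move=> x y [a ax] [b bx]; exists (a + b)%R; rewrite zexpgD.
    exact: (congM sL nL).
  move=> x [a ax]; exists (- a)%R; rewrite zexpgN.
  by apply: (congV sL (subgroup_setT E) nL).
have LK : L `<=` K by move=> x Lx; exists 0%R; apply/cong1.
have nK : normal_in K [set: E].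
  split=> // x e [a ax] _; exists a.
  apply: (cong_trans sL _ (congJ nL (y := e) I ax)).
  rewrite -[e](mulVKg (zexpg t (psi e))) conjgM.
  have -> : zexpg (t ^+ n) a ^ zexpg t (psi e) = zexpg (t ^+ n) a.
    rewrite -[t ^+ n]/(zexpg t (Posz n)) -zexpgM; apply/conjg_fixP/commgP.
    exact: zexpg_commute.
  set z := zexpg _ a; set h := _^-1 * e.
  have hz : cong L (h ^ z) h.
    by apply: (cong_sym sL); apply: (subgroupZ a sZ nP); apply: zexpt_ker.
  by rewrite cong_conjC.
have [x|N NK] := @finite_index_reps _ K
    [seq t ^+ i * r | i <- iota 0 n, r <- s] sK nK.
  pose a := psi x; pose q := (a %/ Posz n)%Z; pose c := (a %% Posz n)%Z.
  have c_ge : (0 <= c)%R by rewrite modz_ge0 //; lia.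
  have c_lt : (c < Posz n)%R by rewrite ltz_pmod //; lia.
  have aE : a = (c + Posz n * q)%R by rewrite {1}(divz_eq a (Posz n)) /c /q; lia.
  have [r rs rx] := repsL (zexpt_ker x).
  case: (c) c_ge c_lt aE => // i _ im aE.
  exists (t ^+ i * r).
    by apply/allpairsP; exists (i, r); split=> //; rewrite mem_iota /=; lia.
  have xE : x = t ^+ i * zexpg (t ^+ n) q * ((zexpg t (psi x))^-1 * x).
    by rewrite -/a {1}aE zexpgD zexpgM /= mulgA mulgV mul1g.
  have -> : cong K (t ^+ i * r) x = K (zexpg (t ^+ n) q ^ r *
      (r^-1 * ((zexpg t (psi x))^-1 * x))).
    rewrite /cong [in LHS]xE; congr (K _).
    by rewrite /conjg invgM !mulgA mulgVK mulgK.
  have [_ KM _] := sK; apply: KM; last exact: LK.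
  by apply: nK.2 => //; exists q; apply: cong_refl.
exists N; rewrite NK => h Hh [a ah]; apply: LH => //; apply/cong1.
suff a0 : a = 0%R by rewrite -[1]/(zexpg (t ^+ n) 0%R) -a0.
have := psiL ah; rewrite psiM psiV psiZ (psiH Hh).
by rewrite -[t ^+ n]/(zexpg t (Posz n)) psiZ psit; nia.
Qed.

End Kernel.

(** An element of height 0 is moved into [H] by a power of [t] and separated there; conjugation by
    [t] is the required injective endomorphism of [H]. *)
Lemma ascending_residually_finite : residually_finite E.
Proof.
move=> e /eqP e1.
have [e0|] := pselect (psi e = 0%R); last exact: separate_outside_kernel.
have [k Hp] := kerP e0.
have pP := polycyclic_subgroup_type sH pH.
have vM := @subgroup_valM E H sH.
pose phi (h : subgroup_type sH) : subgroup_type sH :=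
  exist _ (val h ^ t) (mem_set (Ht (subgroup_valP h))).
have phiE h : val (phi h) = val h ^ t by [].
have phiM : {morph phi : x y / x * y}.
  by move=> x y; apply: val_inj; rewrite vM !phiE vM conjMg.
have phiI : injective phi.
  by move=> x y /(congr1 val); rewrite !phiE => /conjg_inj/val_inj.
have [p pE] := subgroup_val_ex sH Hp.
have p1 : p <> 1.
  move=> p1; apply: e1; apply: (@conjg_inj _ (t ^+ k)).
  by rewrite conj1g -pE p1 (morphg1 vM).
have [M [sM nM phiMM nMp [m m0 mP]]] :=
  polycyclic_invariant_separation pP phiM phiI p1.
have [l [F [x pcF]]] := polycyclic_series pP.
have F0 : F 0%N = setT by case: pcF.
have [||s [_ sP]] := pc_finite_reps pcF (leq0n l) sM _ m0.
- by move=> y h My _; apply: nM.2.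
- by move=> y _; apply: mP.
have vP (y : subgroup_type sH) : (val @` M) (val y) <-> M y.
  by split=> [[z Mz /val_inj <-]|My]; last by exists y.
have [||||||N NP] := @separate_in_kernel (val @` M) _ _ _ _ (map val s).
- exact: subgroup_image.
- by move=> _ [y _ <-]; apply: subgroup_valP.
- move=> _ h [y My <-] /(subgroup_val_ex sH)[h' <-].
  by exists (y ^ h'); [apply: nM.2|rewrite (morphgJ vM)].
- by move=> _ /(subgroup_val_ex sH)[h <-]; rewrite -phiE !vP.
- by move=> _ /mapP[h _ ->]; apply: subgroup_valP.
- move=> _ /(subgroup_val_ex sH)[h <-].
  have [|r rs rh] := sP h; first by rewrite F0.
  exists (val r); first exact: map_f.
  by rewrite /cong -(morphgV vM) -vM; apply/vP.
exists N => Ne; apply: nMp; apply/vP; rewrite pE; apply: NP => //.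
exact: (normal_conjP N).2.
Qed.

End ResidualFiniteness.

(** * Ascending HNN extensions *)

Lemma polycyclic_set_image (G K : groupType) (f : G -> K) :
  {morph f : x y / x * y} -> polycyclic G -> polycyclic_set (range f).
Proof.
move=> fM [n [H [H0 Hn sH cH]]]; exists n, (fun i => f @` H i); split.
- by rewrite H0.
- by rewrite Hn image_set1 (morphg1 fM).
- by move=> i il; apply: subgroup_image => //; apply: sH.
- move=> i il; have [[HS nH] [x Hx xP]] := cH i il; split.
    split; first exact: image_subset.
    move=> _ _ [y Hy <-] [h Hh <-]; exists (y ^ h); first exact: nH.
    by rewrite (morphgJ fM).
  exists (f x); first by exists x.
  move=> _ [y /xP[k [ky|ky]] <-]; exists k; [left|right].
    by exists ((x ^+ k)^-1 * y); rewrite // fM (morphgV fM) (morphgX fM).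
  by exists (x ^+ k * y); rewrite // fM (morphgX fM).
Qed.

(** The pulled-back series of [X] ends at the kernel of [f], where the series of the kernel takes
    over. *)
Lemma polycyclic_set_preimage (E G : groupType) (f : E -> G) (X : set G) :
  {morph f : x y / x * y} -> (forall y, exists x, f x = y) ->
  polycyclic_set (f @^-1` [set 1]) -> polycyclic_set X ->
  polycyclic_set (f @^-1` X).
Proof.
move=> fM f_surj [m [A [A0 Am sA cA]]] [n [H [H0 Hn sH cH]]].
pose F i := if (i < n)%N then f @^-1` H i else A (i - n)%N.
have FE i : (i <= n)%N -> F i = f @^-1` H i.
  rewrite leq_eqVlt => /predU1P[->|il]; last by rewrite /F il.
  by rewrite /F ltnn subnn A0 Hn.
have FA i : F (n + i)%N = A i by rewrite /F ltnNge leq_addr /= addKn.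
exists (n + m)%N, F; split.
- by rewrite FE // H0.
- by rewrite FA.
- move=> i il; case: (leqP i n) => [i_n|/ltnW n_i].
    by rewrite FE //; apply: subgroup_preimage => //; apply: sH.
  by rewrite -(subnKC n_i) FA; apply: sA; lia.
- move=> i il; case: (ltnP i n) => [i_n|n_i]; last first.
    rewrite -(subnKC n_i) -addnS !FA; apply: cA; lia.
  rewrite !FE ?(ltnW i_n) //; have [[HS nH] [x Hx xP]] := cH i i_n; split.
    split=> [y|y h]; first exact: HS.
    by rewrite /preimage /= (morphgJ fM); apply: nH.
  have [x' x'E] := f_surj x; exists x'; first by rewrite /preimage /= x'E.
  move=> y /xP[k ky]; exists k.
  by rewrite /preimage /= !fM (morphgV fM) (morphgX fM) x'E.
Qed.

(** List the elements of [A]; the spans of the tails of the list form the series. *)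
Lemma polycyclic_set_finite_abelian (E : groupType) (A : set E) :
  is_subgroup A -> finite_set A -> (forall x y, A x -> A y -> commute x y) ->
  polycyclic_set A.
Proof.
move=> sA /finite_seqP[s As] cA; have [A1 AM AV] := sA.
pose fix span (s : seq E) : set E := if s is a :: s' then
  [set zexpg a p.1 * p.2 | p in [set p : int * E | span s' p.2]] else [set 1].
have sub_span r : (forall x, x \in r -> A x) -> span r `<=` A.
  elim: r => [|a r IHr] rA /= w; first by move=> ->.
  move=> [[k c] /= rc <-]; apply: AM.
    by apply: subgroupZ => //; apply: rA; rewrite mem_head.
  by apply: IHr rc => x xr; apply: rA; rewrite inE xr orbT.
have sub_behead a r : (forall x, x \in a :: r -> A x) -> forall x, x \in r -> A x.
  by move=> rA x xr; apply: rA; rewrite inE xr orbT.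
have span_subgroup r : (forall x, x \in r -> A x) -> is_subgroup (span r).
  elim: r => [|a r IHr] rA /=; first exact: subgroup_set1.
  have rA' := sub_behead _ _ rA; have [S1 SM SV] := IHr rA'.
  have Aa k : A (zexpg a k) by apply: subgroupZ => //; apply: rA; rewrite mem_head.
  have Sr := sub_span r rA'.
  split; first by exists (0%R, 1); rewrite //= mulg1.
    move=> _ _ [[k c] /= rc <-] [[j d] /= rd <-]; exists ((k + j)%R, c * d).
      exact: SM.
    rewrite /= zexpgD !mulgA; congr (_ * _); rewrite -!mulgA; congr (_ * _).
    by apply: cA => //; apply: Sr.
  move=> _ [[k c] /= rc <-]; exists ((- k)%R, c^-1); first exact: SV.
  by rewrite /= zexpgN -invgM; congr (_^-1); apply: cA => //; apply: Sr.
have sA' x : x \in s -> A x by rewrite As.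
have dropA i x : x \in drop i s -> A x by move=> /mem_drop/sA'.
exists (size s), (fun i => span (drop i s)); split.
- rewrite drop0 eqEsubset; split; first exact: sub_span.
  rewrite As => x /=; elim: (s) (sA') => // a r IHr rA.
  rewrite inE => /predU1P[->|xr].
    exists (1%R, 1); last by rewrite /= mulg1.
    by case: (span_subgroup r (sub_behead _ _ rA)).
  by exists (0%R, x); rewrite /= ?mul1g //; apply: IHr xr; apply: sub_behead rA.
- by rewrite drop_size.
- by move=> i _; apply/span_subgroup/dropA.
- move=> i il; have := dropA i; rewrite (drop_nth 1 il).
  move: (nth _ _ _) => a rA.
  have sr := span_subgroup _ (dropA i.+1); have rA' := sub_span _ (dropA i.+1).
  have aA := sub_span _ rA.
  split; last first.
    exists a; first by exists (1%R, 1); rewrite /= ?mulg1 //; case: sr.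
    move=> _ [[k c] /= rc <-]; case: k => k; [exists k; left|exists k.+1; right].
      by rewrite mulgA mulVg mul1g.
    by rewrite mulgA mulgV mul1g.
  split=> [c rc|c h rc /aA Ah]; first by exists (0%R, c); rewrite //= mul1g.
  suff -> : c ^ h = c by [].
  by apply/conjg_fixP/commgP; apply: cA => //; apply: rA'.
Qed.

Section HNN.
Variables (G : groupType) (phi : {multiplicative G -> G}).
Local Notation Gamma := (ascending_hnn phi).

Definition hnn_class (u : hnn_word G) : Gamma := \pi_(ascending_hnn phi) u.

Lemma hnn_class_cat u v : hnn_class (u ++ v) = hnn_class u * hnn_class v.
Proof. by apply/hnn_piP; apply: hnn_cat; apply/hnn_sym/hnn_reprP. Qed.

Definition hnn_base (g : G) : Gamma := hnn_class [:: inl g].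
Definition hnn_t : Gamma := hnn_class [:: inr false].

Lemma hnn_baseM : {morph hnn_base : g h / g * h}.
Proof.
by move=> g h; rewrite /hnn_base -hnn_class_cat; apply/hnn_piP/hnn_sym/hnn_mul.
Qed.

Lemma hnn_tVE : hnn_t^-1 = hnn_class [:: inr true].
Proof.
apply: mulg1_eq; rewrite -hnn_class_cat; exact/hnn_piP/hnn_tV.
Qed.

Lemma hnn_base_conj g : hnn_base g ^ hnn_t = hnn_base (phi g).
Proof.
rewrite /conjg hnn_tVE -[hnn_base g * _]hnn_class_cat -hnn_class_cat.
exact/hnn_piP/(hnn_conj phi g).
Qed.

Lemma hnn_base_conjX g k :
  hnn_base g ^ (hnn_t ^+ k) = hnn_base (iter k phi g).
Proof.
elim: k g => [|k IHk] g; first by rewrite conjg1.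
by rewrite expgS conjgM hnn_base_conj IHk iterSr.
Qed.

(** Letters are absorbed from the left by the rules [h t^a = t^a phi^a(h)] and
    [t^-1 g = phi(g) t^-1]. *)
Lemma hnn_normal_form u : exists a g b,
  hnn_class u = hnn_t ^+ a * hnn_base g * (hnn_t ^+ b)^-1.
Proof.
elim: u => [|[h|[]] u [a [g [b uE]]]].
- exists 0%N, 1, 0%N; rewrite expg0 invg1 mulg1 mul1g.
  exact/hnn_piP/hnn_sym/hnn_one.
- exists a, (iter a phi h * g), b.
  by rewrite -cat1s hnn_class_cat uE -/(hnn_base h) hnn_baseM -hnn_base_conjX
    /conjg !mulgA mulgV mul1g.
- rewrite -cat1s hnn_class_cat uE -hnn_tVE; case: a {uE} => [|a].
    exists 0%N, (phi g), b.+1; rewrite -hnn_base_conj !expg0 !mul1g /conjg.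
    by rewrite expgSr invgM !mulgA mulgK.
  by exists a, g, b; rewrite expgS !mulgA mulVg mul1g.
- exists a.+1, g, b; rewrite -cat1s hnn_class_cat uE -/hnn_t.
  by rewrite expgS !mulgA.
Qed.

Definition letter_weight (l : hnn_letter G) : int :=
  match l with inl _ => 0%R | inr b => if b then (-1)%R else 1%R end.

Definition word_weight (u : hnn_word G) : int := (\sum_(l <- u) letter_weight l)%R.

Lemma word_weight_eq u v : hnn_eq phi u v -> word_weight u = word_weight v.
Proof.
rewrite /word_weight.
elim=> {u v} //; rewrite ?big_cons ?big_nil //=.
- by move=> u v w _ -> _ ->.
- by move=> u u' v v' _ uu' _ vv'; rewrite !big_cat /= uu' vv'.
- by move=> g h; rewrite !big_cons !big_nil.
- by move=> g; rewrite !big_cons !big_nil.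
Qed.

(** The exponent sum of [t], which plays the role of the height map [psi]. *)
Definition hnn_weight (x : Gamma) : int := word_weight (repr x).

Lemma hnn_weight_class u : hnn_weight (hnn_class u) = word_weight u.
Proof. exact/word_weight_eq/hnn_reprP. Qed.

Lemma hnn_weightM x y : hnn_weight (x * y) = (hnn_weight x + hnn_weight y)%R.
Proof.
rewrite -[x]reprK -[y]reprK -!/(hnn_class _) -hnn_class_cat !hnn_weight_class.
by rewrite /word_weight big_cat.
Qed.

Lemma hnn_weight_base g : hnn_weight (hnn_base g) = 0%R.
Proof. by rewrite hnn_weight_class /word_weight big_cons big_nil. Qed.

Lemma hnn_weight_t : hnn_weight hnn_t = 1%R.
Proof. by rewrite hnn_weight_class /word_weight big_cons big_nil. Qed.

Lemma hnn_weight_kernel x :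
  hnn_weight x = 0%R -> exists k, range hnn_base (x ^ (hnn_t ^+ k)).
Proof.
have [a [g [b xE]]] := hnn_normal_form (repr x).
rewrite /hnn_class reprK in xE; rewrite xE.
have tX n : hnn_weight (hnn_t ^+ n) = Posz n.
  elim: n => [|n IHn]; last by rewrite expgS hnn_weightM IHn hnn_weight_t; lia.
  by apply: (addrI (hnn_weight 1)); rewrite -hnn_weightM mulg1 addr0.
have tV y : hnn_weight y^-1 = (- hnn_weight y)%R.
  apply: (addrI (hnn_weight y)); rewrite -hnn_weightM mulgV subrr; exact: (tX 0%N).
rewrite !hnn_weightM tV !tX hnn_weight_base => ab.
have -> : b = a by lia.
by exists a, g => //; rewrite /conjg !mulgA mulVg mul1g mulgVK.
Qed.

(** The base is the preimage of the image of [G], finite abelian by polycyclic; the stable letter is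
    any lift of [t]. *)
Lemma hnn_extension_residually_finite (E : groupType) (f : E -> Gamma) :
  polycyclic G -> {morph f : x y / x * y} -> (forall y, exists x, f x = y) ->
  finite_set (f @^-1` [set 1]) ->
  (forall x y, f x = 1 -> f y = 1 -> commute x y) ->
  residually_finite E.
Proof.
move=> pG fM f_surj fin_ker ab_ker; have [t tE] := f_surj hnn_t.
have sR : is_subgroup (range hnn_base).
  by apply: (subgroup_image hnn_baseM); apply: subgroup_setT.
apply: (@ascending_residually_finite E (f @^-1` range hnn_base) t
  (fun e => hnn_weight (f e))).
- exact: subgroup_preimage.
- apply: polycyclic_set_preimage => //; last exact: polycyclic_set_image hnn_baseM pG.
  apply: polycyclic_set_finite_abelian => //.
  by apply: subgroup_preimage => //; apply: subgroup_set1.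
- move=> h [g _ gh]; rewrite /preimage /= (morphgJ fM) tE -gh hnn_base_conj.
  by exists (phi g).
- by move=> x y; rewrite fM hnn_weightM.
- by move=> h [g _ <-]; apply: hnn_weight_base.
- by rewrite tE hnn_weight_t.
- move=> e /hnn_weight_kernel[k kP]; exists k.
  by rewrite /preimage /= (morphgJ fM) (morphgX fM) tE.
Qed.

Lemma hnn_residually_finite : polycyclic G -> residually_finite Gamma.
Proof.
move=> pG; apply: (@hnn_extension_residually_finite Gamma id) => //.
- by move=> y; exists y.
- exact: finite_set1.
- by move=> x y -> ->.
Qed.

End HNN.

(** * Cochains inflated from finite quotients *)

Section ZmodCancel.
Variable A : zmodType.
Implicit Types t x y : A.
Local Open Scope ring_scope.

Lemma zmod_cancelN t u x : t = u + x -> u = 0 -> t - x = 0.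
Proof. by move=> -> ->; rewrite add0r subrr. Qed.

Lemma zmod_cancelP t u x : t = u - x -> u = 0 -> t + x = 0.
Proof. by move=> -> ->; rewrite add0r addNr. Qed.

Lemma zmod_skip t u x y : t = u + x -> t + y = u + y + x.
Proof. by move=> ->; rewrite addrAC. Qed.

End ZmodCancel.

Ltac zmod_find :=
  first [ reflexivity | exact (esym (add0r _)) | eapply zmod_skip; zmod_find ].

Ltac zmod_loop :=
  first [ reflexivity
        | eapply zmod_cancelN; [zmod_find | zmod_loop]
        | eapply zmod_cancelP; [zmod_find | zmod_loop] ].

(* Decides identities between sums of atoms and their opposites. *)
Ltac zmod :=
  apply: subr0_eq; rewrite ?(opprD, opprK, oppr0, addr0, add0r, addrA); zmod_loop.

Section FiniteIndex.
Variable G : groupType.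
Implicit Types (N K : finite_index_normal G).

(** Numbers the cosets, [kappa] giving the class and [sigma] a representative, so that functions on
    [G / N] become finite functions on an ordinal. *)
Lemma finite_index_classify N : exists m (kappa : G -> 'I_m) (sigma : 'I_m -> G),
  (forall i, kappa (sigma i) = i) /\
  (forall x y, kappa x = kappa y <-> cong N x y).
Proof.
have /finite_seqP[s sE] := finite_indexP N.
have inS (z : quotient_group N) : z \in undup s.
  by rewrite mem_undup; have : [set: quotient_group N] z by []; rewrite sE.
exists (size (undup s)).
have lt_s x : (index (\pi_(quotient_group N) x) (undup s) < size (undup s))%N.
  by rewrite index_mem.
exists (fun x => Ordinal (lt_s x)), (fun i => repr (nth (1 : quotient_group N) (undup s) i)).
split=> [i|x y]; first by apply: val_inj; rewrite /= reprK index_uniq ?undup_uniq.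
split=> [/(congr1 val) /= /(congr1 (nth (1 : quotient_group N) (undup s)))|xy].
  by rewrite !nth_index // => /coset_piP.
by apply: val_inj => /=; congr index; apply/coset_piP.
Qed.

Lemma finite_index_of_classifier (S : set G) (T : finType) (kappa : G -> T) :
  is_subgroup S -> normal_in S [set: G] ->
  (forall x y, kappa x = kappa y -> cong S x y) ->
  exists N : finite_index_normal G, normal_set N = S.
Proof.
move=> sS nS kS.
have /choice[sigma sigmaP] : forall t, exists y, forall x, kappa x = t -> kappa y = t.
  move=> t; have [[y yt]|nt] := pselect (exists y, kappa y = t); first by exists y.
  by exists 1 => x xt; case: nt; exists x.
apply: (@finite_index_reps _ S (map sigma (enum T))) => // y.
exists (sigma (kappa y)); first by apply: map_f; rewrite mem_enum.
by apply: kS; apply: (sigmaP _ y).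
Qed.

Lemma finite_index_subgroup N : is_subgroup N. Proof. exact: normal_subgroupP. Qed.
Lemma finite_index_normalT N : normal_in N [set: G]. Proof. exact: normal_conjP. Qed.

Lemma finite_index_setI N K : exists L : finite_index_normal G, normal_set L = N `&` K.
Proof.
have [m [kN [_ [_ kNP]]]] := finite_index_classify N.
have [n [kK [_ [_ kKP]]]] := finite_index_classify K.
apply: (@finite_index_of_classifier _ ('I_m * 'I_n)%type (fun x => (kN x, kK x))).
- by apply: subgroupI; apply: finite_index_subgroup.
- split=> // y h [Ny Ky] _; split; exact: (finite_index_normalT _).2.
- by move=> x y [/kNP ? /kKP ?].
Qed.

Lemma finite_index_setT : exists L : finite_index_normal G, normal_set L = setT.
Proof.
apply: (@finite_index_of_classifier _ unit (fun=> tt)) => //; exact: subgroup_setT.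
Qed.

Lemma finite_index_bigcap (T : finType) (P : T -> finite_index_normal G) :
  exists L : finite_index_normal G, forall i, L `<=` P i.
Proof.
suff [L LP] : exists L : finite_index_normal G, forall i, i \in enum T -> L `<=` P i.
  by exists L => i; apply: LP; rewrite mem_enum.
elim: (enum T) => [|i s [L LP]]; first by have [L _] := finite_index_setT; exists L.
have [L' L'E] := finite_index_setI L (P i); exists L' => j.
rewrite L'E inE => /predU1P[->|/LP Lj] x []//.
by move=> /Lj.
Qed.

Lemma residually_finite_finType (T : finType) (e : T -> G) :
  residually_finite G -> (forall i, e i <> 1) ->
  exists N : finite_index_normal G, forall i, ~ normal_set N (e i).
Proof.
move=> rfG e1.
have /choice[P PP] : forall i, exists N : finite_index_normal G, ~ normal_set N (e i).
  by move=> i; apply: rfG; apply/eqP.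
have [L LP] := finite_index_bigcap P.
by exists L => i Le; apply: (PP i); apply: LP.
Qed.

End FiniteIndex.

Section Module.
Variables (G : groupType) (A : finZmodType) (M : gmodule G A).

Definition coboundary1 (k : G -> A) (g h : G) : A :=
  (M g (k h) - k (g * h)%g + k g)%R.

Definition coboundary2 (f : G -> G -> A) (g h l : G) : A :=
  (M g (f h l) - f (g * h)%g l + f g (h * l)%g - f g h)%R.

Definition inflated1 (N : set G) (k : G -> A) : Prop :=
  forall g g', cong N g g' -> k g = k g'.
Definition inflated2 (N : set G) (f : G -> G -> A) : Prop :=
  forall g g' h h', cong N g g' -> cong N h h' -> f g h = f g' h'.
Definition inflated3 (N : set G) (f : G -> G -> G -> A) : Prop :=
  forall g g' h h' l l', cong N g g' -> cong N h h' -> cong N l l' ->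
    f g h l = f g' h' l'.

Definition acts_trivially (N : set G) : Prop := forall g a, N g -> M g a = a.

Lemma acts_trivially_cong (N : set G) g h a :
  acts_trivially N -> cong N g h -> M g a = M h a.
Proof. by move=> tN gh; rewrite -(mulVKg g h) gactM (tN _ _ gh). Qed.

(* Modulo B, the function n |-> k n - k 1 is a homomorphism on the subgroup on
   which w is constant and M trivial; its kernel has finite index. *)
Lemma inflate_primitive (B : set A) (N : finite_index_normal G)
    (w : G -> G -> A) (k : G -> A) :
  B 0%R -> (forall a b, B a -> B b -> B (a - b)%R) -> (forall g a, B a -> B (M g a)) ->
  acts_trivially N -> inflated2 N w ->
  (forall g h, B (w g h - coboundary1 k g h)%R) ->
  exists (K : finite_index_normal G) (k' : G -> A),
    inflated1 K k' /\ forall g, B (k g - k' g)%R.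
Proof.
move=> B0 BB BM tN iw wk.
have BN a : B a -> B (- a)%R by move=> Ba; rewrite -sub0r; apply: BB.
have BD a b : B a -> B b -> B (a + b)%R.
  by move=> Ba Bb; rewrite -[b]opprK; apply: BB => //; apply: BN.
have sN := finite_index_subgroup N; have nN := finite_index_normalT N.
have [N1 NM NV] := sN.
have kr g n : normal_set N n -> B (k (g * n)%g - k g - M g (k n - k 1%g))%R.
  move=> Nn; have wgn : w g 1 = w g n by apply: iw; [exact: cong_refl|apply/cong1].
  have := BB _ _ (wk g n) (wk g 1%g); rewrite /coboundary1 mulg1 wgn gactD gactN.
  by congr (B _); zmod.
have kl g n : normal_set N n -> B (k (n * g)%g - k g - (k n - k 1%g))%R.
  move=> Nn; have wgn : w 1 g = w n g by apply: iw; [apply/cong1|exact: cong_refl].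
  have := BB _ _ (wk n g) (wk 1 g); rewrite /coboundary1 mul1g wgn gact1 (tN n) //.
  by congr (B _); zmod.
pose S : set G := [set n | normal_set N n /\ B (k n - k 1%g)%R].
have sS : is_subgroup S.
  split.
  - by split=> //; rewrite subrr.
  - move=> x y [Nx Bx] [Ny By]; split; first exact: NM.
    have := BD _ _ (kl y x Nx) (BD _ _ Bx By); congr (B _); zmod.
  - move=> x [Nx Bx]; split; first exact: NV.
    have := BB _ _ (BN _ (kl x x^-1 (NV _ Nx))) Bx; rewrite mulVg; congr (B _); zmod.
have nS : normal_in S [set: G].
  split=> // n g [Nn Bn] _; have Nng : normal_set N (n ^ g) by apply: nN.2.
  split=> //; have := kr g _ Nng; rewrite -conjgC => kng.
  have BMg : B (M g (k (n ^ g)%g - k 1%g))%R.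
    by have := BD _ _ (BB _ _ (kl g n Nn) kng) Bn; congr (B _); zmod.
  by have := BM g^-1 _ BMg; rewrite -gactM mulVg gact1.
(* The class modulo [N] and the value of [k] determine the class modulo [S]; finiteness of [A] thus
   gives finite index. *)
have SK g h : normal_set N (g^-1 * h) -> k g = k h -> cong S g h.
  move=> Ngh kgh; split=> //; have := BN _ (kr g _ Ngh).
  rewrite mulVKg kgh subrr sub0r opprK => BMg.
  by have := BM g^-1 _ BMg; rewrite -gactM mulVg gact1.
have [m [kappa [_ [_ kappaP]]]] := finite_index_classify N.
have [K KE] : exists K : finite_index_normal G, normal_set K = S.
  apply: (@finite_index_of_classifier _ _ ('I_m * A)%type (fun x => (kappa x, k x))) => //.
  by move=> x y [/kappaP xy kxy]; apply: SK.
exists K, (fun g => k (repr (\pi_(quotient_group K) g))); split=> [g g' gg'|g].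
  by congr (k (repr _)); apply/coset_piP.
have : normal_set K ((repr (\pi_(quotient_group K) g))^-1 * g).
  by apply/coset_piP; rewrite reprK.
rewrite KE; set r := repr _; move=> [Nr Br].
have := BD _ _ (kr r _ Nr) (BM r _ Br); rewrite mulVKg; congr (B _); zmod.
Qed.

End Module.

(** * The group extension defined by a 2-cocycle *)

Section TwistedProduct.
Variables (G : groupType) (A : finZmodType) (M : gmodule G A) (f : G -> G -> A).
Hypothesis cf : forall g h l, coboundary2 M f g h l = 0%R.

(* The dummy [cf] lets the group structure be inferred from the type. *)
Definition twisted_product : Type := let _ := cf in (A * G)%type.

HB.instance Definition _ := Choice.on twisted_product.

Lemma cocycle_shift g h l :
  (M g (f h l) + f g (h * l)%g = f (g * h)%g l + f g h)%R.
Proof. by have := cf g h l; rewrite /coboundary2 => h0; apply: subr0_eq; rewrite -h0; zmod. Qed.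

Lemma cocycle_1g g : f 1 g = f 1 1.
Proof.
have := cocycle_shift 1 1 g; rewrite !mul1g gact1 => /addrI; exact.
Qed.

Lemma cocycle_g1 g : f g 1 = M g (f 1 1).
Proof.
by have := cocycle_shift g 1 1; rewrite !mulg1 [RHS]addrC => /addIr.
Qed.

(** The cocycle is not normalized, so the unit carries the correction [- f 1 1]; the embedding
    [twisted_inj] of [A] is shifted in the same way. *)
Definition twisted_one : twisted_product := ((- f 1 1)%R, 1).
Definition twisted_mul (x y : twisted_product) : twisted_product :=
  ((x.1 + M x.2 y.1 + f x.2 y.2)%R, x.2 * y.2).
Definition twisted_inv (x : twisted_product) : twisted_product :=
  ((- M (x.2^-1)%g x.1 - f (x.2^-1)%g x.2 - f 1%g 1%g)%R, x.2^-1).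

Lemma twisted_mulA : associative twisted_mul.
Proof.
move=> [a g] [b h] [c l]; rewrite /twisted_mul /= mulgA; congr pair.
rewrite !gactD gactM -!addrA; congr (_ + (_ + _))%R.
by rewrite cocycle_shift; zmod.
Qed.

Lemma twisted_mul1g : left_id twisted_one twisted_mul.
Proof.
move=> [a g]; rewrite /twisted_mul /twisted_one /= mul1g gact1 cocycle_1g; congr pair; zmod.
Qed.

Lemma twisted_mulg1 : right_id twisted_one twisted_mul.
Proof.
by move=> [a g]; rewrite /twisted_mul /twisted_one /= mulg1 gactN (cocycle_g1 g); congr pair; zmod.
Qed.

Lemma twisted_mulVg : left_inverse twisted_one twisted_inv twisted_mul.
Proof.
move=> [a g]; rewrite /twisted_mul /twisted_one /= mulVg; congr pair; zmod.
Qed.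

Lemma twisted_mulgV : right_inverse twisted_one twisted_inv twisted_mul.
Proof.
move=> [a g]; rewrite /twisted_mul /twisted_one /= mulgV; congr pair.
have := cocycle_shift g g^-1 g; rewrite mulVg mulgV cocycle_1g (cocycle_g1 g) => E.
rewrite !gactD !gactN -gactM mulgV gact1.
have -> : M g (f g^-1 g) = (f 1%g 1%g + f g (g^-1)%g - M g (f 1%g 1%g))%R.
  by rewrite -E addrK.
zmod.
Qed.

HB.instance Definition _ := isGroup.Build twisted_product
  twisted_mulA twisted_mul1g twisted_mulg1 twisted_mulVg twisted_mulgV.

Definition twisted_pair (a : A) (g : G) : twisted_product := (a, g).

Lemma twisted_pairM a b g h :
  twisted_pair a g * twisted_pair b h = twisted_pair (a + M g b + f g h)%R (g * h).
Proof. by []. Qed.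

Definition twisted_snd (x : twisted_product) : G := x.2.

Lemma twisted_sndM : {morph twisted_snd : x y / x * y}.
Proof. by []. Qed.

Definition twisted_inj (a : A) : twisted_product := twisted_pair (a - f 1%g 1%g)%R 1.

Lemma twisted_injM a b h :
  twisted_inj a * twisted_pair b h = twisted_pair (a + b)%R h.
Proof.
by rewrite /twisted_inj twisted_pairM gact1 mul1g cocycle_1g; congr twisted_pair; zmod.
Qed.

Lemma twisted_inj0 : twisted_inj 0%R = 1.
Proof. by rewrite /twisted_inj sub0r. Qed.

Lemma twisted_injD a b : twisted_inj (a + b)%R = twisted_inj a * twisted_inj b.
Proof. by rewrite twisted_injM /twisted_inj addrA. Qed.

Lemma twisted_inj_eq1 a : twisted_inj a = 1 -> a = 0%R.
Proof. by move=> /(congr1 fst) E; apply: (addIr (- f 1%g 1%g)%R); rewrite add0r. Qed.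

Lemma twisted_kerP x : twisted_snd x = 1 -> exists a, x = twisted_inj a.
Proof.
move: x => [a g] /= ->; exists (a + f 1%g 1%g)%R.
by rewrite /twisted_inj addrK.
Qed.

(** Choose [K] of finite index meeting the finite group [A] trivially, and a section of the
    extension that modulo [K] depends only on the class in [G / N], where [N] is the image of [K].
    The cocycle of this section has values in [A] and is determined modulo [K], hence inflated from
    [G / N]. *)
Lemma twisted_inflate : residually_finite twisted_product ->
  exists (N : finite_index_normal G) (u : G -> A),
    inflated2 N (fun g h => f g h - coboundary1 M u g h)%R.
Proof.
move=> rf.
have [K KP] := @residually_finite_finType _ {a : A | a != 0%R}
  (fun a => twisted_inj (val a)) rf
  (fun a => fun a1 => elimN eqP (valP a) (twisted_inj_eq1 a1)).
have {}KP a : normal_set K (twisted_inj a) -> a = 0%R.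
  by move=> Ka; apply: contrapT => /eqP a0; apply: (KP (exist _ a a0)).
have sK := finite_index_subgroup K; have nK := finite_index_normalT K.
pose S := twisted_snd @` K.
have [N NE] : exists N : finite_index_normal G, normal_set N = S.
  have [m [kappa [sigma [kS kP]]]] := finite_index_classify K.
  apply: (@finite_index_reps _ S [seq twisted_snd (sigma i) | i <- enum 'I_m]).
  - exact: subgroup_image twisted_sndM sK.
  - split=> // _ h [x Kx <-] _; exists (x ^ twisted_pair 0%R h).
      exact: nK.2.
    by rewrite (morphgJ twisted_sndM).
  - move=> y; pose x := twisted_pair 0%R y; exists (twisted_snd (sigma (kappa x))).
      by apply: map_f; rewrite mem_enum.
    exists ((sigma (kappa x))^-1 * x); first by apply/kP.
    by rewrite twisted_sndM (morphgV twisted_sndM).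
pose rho g := repr (\pi_(quotient_group N) g).
have rhoP g : cong N (rho g) g by apply/coset_piP; rewrite reprK.
have rho_cong g g' : cong N g g' -> rho g = rho g'.
  by move=> gg'; congr repr; apply/coset_piP.
have /choice[u uP] : forall g, exists a,
    cong K (twisted_pair 0%R (rho g)) (twisted_pair a g).
  move=> g; have := rhoP g; rewrite /cong NE => -[[a h] Kah /= hE].
  exists (0 + M (rho g) a + f (rho g) h)%R.
  have -> : twisted_pair (0 + M (rho g) a + f (rho g) h)%R g =
      twisted_pair 0%R (rho g) * twisted_pair a h.
    by rewrite twisted_pairM hE mulVKg.
  by rewrite mulKg.
have u_cong g g' : cong N g g' -> cong K (twisted_pair (u g) g) (twisted_pair (u g') g').
  move=> gg'; apply: (cong_trans sK (cong_sym sK (uP g))).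
  by rewrite (rho_cong _ _ gg').
exists N, (fun g => - u g)%R => g g' h h' gg' hh'.
(* The corrected cocycle measures how far the section [g |-> (u g, g)] is from a homomorphism. *)
have FE x y : twisted_inj (f x y - coboundary1 M (fun g => - u g)%R x y)%R =
    twisted_pair (u x) x * twisted_pair (u y) y * (twisted_pair (u (x * y)) (x * y))^-1.
  apply: (mulIg (twisted_pair (u (x * y)) (x * y))).
  rewrite mulgVK twisted_injM twisted_pairM /coboundary1 gactN; congr twisted_pair.
  zmod.
set a := (_ - _)%R; set b := (_ - _)%R.
suff ab : cong K (twisted_inj a) (twisted_inj b).
  apply/esym/subr0_eq/KP; move: ab; rewrite /cong.
  have -> : (twisted_inj a)^-1 = twisted_inj (- a)%R.
    by apply: mulg1_eq; rewrite -twisted_injD subrr twisted_inj0.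
  by rewrite -twisted_injD addrC.
rewrite /a /b !FE.
have sN := finite_index_subgroup N; have nN := finite_index_normalT N.
apply: (congM sK nK) => //; first by apply: (congM sK nK) => //; apply: u_cong.
apply: (congV sK (subgroup_setT _) nK) => //; apply: u_cong.
exact: (congM sN nN).
Qed.

End TwistedProduct.

(** The interface between the two halves: the cohomological argument sees the HNN extension only
    through this property. *)
Definition abelian_extensions_rf (G : groupType) : Prop :=
  forall (E : groupType) (f : E -> G), {morph f : x y / x * y} ->
    (forall y, exists x, f x = y) -> finite_set (f @^-1` [set 1]) ->
    (forall x y, f x = 1 -> f y = 1 -> commute x y) -> residually_finite E.

Section Inflation.
Variable G : groupType.
Hypothesis rfG : abelian_extensions_rf G.

Lemma inflate_cocycle2 (A : finZmodType) (M : gmodule G A) (f : G -> G -> A) :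
  (forall g h l, coboundary2 M f g h l = 0%R) ->
  exists (N : finite_index_normal G) (u : G -> A),
    inflated2 N (fun g h => f g h - coboundary1 M u g h)%R.
Proof.
move=> cf; apply: (@twisted_inflate _ _ _ _ cf).
apply: (rfG (@twisted_sndM _ _ _ _ cf)).
- by move=> y; exists (twisted_pair cf 0%R y).
- apply: (@sub_finite_set _ _ (range (twisted_inj cf))).
    by move=> x /twisted_kerP[a ->]; exists a.
  exact: finite_image.
- move=> _ _ /twisted_kerP[a ->] /twisted_kerP[b ->].
  by rewrite /commute -!twisted_injD addrC.
Qed.

End Inflation.

(** Functions on the [m] cosets of a finite-index subgroup; the named type carries both the finite
    and the additive structure. *)
Definition coinduced (A : finZmodType) (m : nat) : Type := {ffun 'I_m -> A}.

HB.instance Definition _ (A : finZmodType) (m : nat) := Finite.on (coinduced A m).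
HB.instance Definition _ (A : finZmodType) (m : nat) := GRing.Zmodule.on (coinduced A m).

Section Coboundaries.
Variables (G : groupType) (A : finZmodType) (M : gmodule G A).

Lemma coboundary1B (u v : G -> A) g h :
  (coboundary1 M (fun x => u x - v x) g h = coboundary1 M u g h - coboundary1 M v g h)%R.
Proof. rewrite /coboundary1 gactD gactN; zmod. Qed.

Lemma coboundary21 (k : G -> A) g h l : coboundary2 M (coboundary1 M k) g h l = 0%R.
Proof.
rewrite /coboundary2 /coboundary1 !gactD !gactN -!gactM !mulgA; zmod.
Qed.

Lemma coboundary2D (f k : G -> G -> A) g h l :
  (coboundary2 M (fun x y => f x y + k x y) g h l =
   coboundary2 M f g h l + coboundary2 M k g h l)%R.
Proof. rewrite /coboundary2 gactD; zmod. Qed.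

Lemma coboundary2B (f k : G -> G -> A) g h l :
  (coboundary2 M (fun x y => f x y - k x y) g h l =
   coboundary2 M f g h l - coboundary2 M k g h l)%R.
Proof. rewrite /coboundary2 gactD gactN; zmod. Qed.

(** The 3-cocycle identity, solved for the term with the action: this is the shape in which
    dimension shifting uses it. *)
Lemma coboundary2_cocycle (f : G -> G -> A) (z : G -> G -> G -> A) g h l p :
  (forall x y w, z x y w = coboundary2 M f x y w) ->
  (z (g * h)%g l p - z g (h * l)%g p + z g h (l * p)%g - z g h l = M g (z h l p))%R.
Proof.
by move=> zf; rewrite !zf /coboundary2 !gactD !gactN -!gactM !mulgA; zmod.
Qed.

Lemma inflated_coboundary1 (N K : finite_index_normal G) (u : G -> A) :
  acts_trivially M N -> inflated1 K u ->
  inflated2 (N `&` K) (coboundary1 M u).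
Proof.
move=> tN iu g g' h h' [Ng Kg] [Nh Kh]; rewrite /coboundary1.
rewrite (iu _ _ Kg) (iu _ _ Kh) (acts_trivially_cong _ tN Ng).
congr (_ - _ + _)%R; apply: iu.
exact: (congM (finite_index_subgroup K) (finite_index_normalT K)).
Qed.

End Coboundaries.

Section Coinduction.
Variables (G : groupType) (A : finZmodType) (M : gmodule G A).
Variables (N : finite_index_normal G) (m : nat) (kappa : G -> 'I_m) (sigma : 'I_m -> G).
Hypothesis kappaK : forall i, kappa (sigma i) = i.
Hypothesis kappaP : forall x y, kappa x = kappa y <-> cong N x y.
Hypothesis tN : acts_trivially M N.

Let A' : finZmodType := coinduced A m.

Lemma cong_sigma x : cong N (sigma (kappa x)) x.
Proof. by apply/kappaP; rewrite kappaK. Qed.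

(** Right translation of functions on [G / N]. *)
Definition coinduced_act (g : G) (F : A') : A' := [ffun i => F (kappa (sigma i * g))].

Lemma coinduced_act1 F : coinduced_act 1 F = F.
Proof. by apply/ffunP => i; rewrite ffunE mulg1 kappaK. Qed.

Lemma coinduced_actM g h F :
  coinduced_act (g * h) F = coinduced_act g (coinduced_act h F).
Proof.
apply/ffunP => i; rewrite !ffunE; congr (F _); apply/kappaP; rewrite mulgA.
apply: (congM (finite_index_subgroup N) (finite_index_normalT N)) => //.
  exact: (cong_sym (finite_index_subgroup N) (cong_sigma _)).
exact: (cong_refl _ (finite_index_subgroup N)).
Qed.

Lemma coinduced_actD g : {morph coinduced_act g : a b / (a + b)%R}.
Proof. by move=> a b; apply/ffunP => i; rewrite !ffunE. Qed.

Definition coinduced_gmodule : gmodule G A' :=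
  GModule coinduced_act1 coinduced_actM coinduced_actD.

Lemma coinduced_acts_trivially : acts_trivially coinduced_gmodule N.
Proof.
move=> g F Ng; apply/ffunP => i; rewrite ffunE; congr (F _).
rewrite -[RHS]kappaK; apply/kappaP; apply: (cong_sym (finite_index_subgroup N)).
by rewrite /cong mulKg.
Qed.

(** The orbit map [x |-> x a], well defined on [G / N] because [N] acts trivially; it embeds [A]
    equivariantly. *)
Definition coinduced_unit (a : A) : A' := [ffun i => M (sigma i) a].

Lemma coinduced_unitD : {morph coinduced_unit : a b / (a + b)%R}.
Proof. by move=> a b; apply/ffunP => i; rewrite !ffunE gactD. Qed.

Lemma coinduced_unit0 : coinduced_unit 0%R = 0%R.
Proof. by apply/ffunP => i; rewrite !ffunE gact0. Qed.

Lemma coinduced_unitN : {morph coinduced_unit : a / (- a)%R}.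
Proof. by move=> a; apply/ffunP => i; rewrite !ffunE gactN. Qed.

Lemma coinduced_unit_inj : injective coinduced_unit.
Proof.
move=> a b /ffunP/(_ (kappa 1)); rewrite !ffunE => /(congr1 (M (sigma (kappa 1))^-1)).
by rewrite -!gactM mulVg !gact1.
Qed.

Lemma coinduced_unit_act g a :
  coinduced_gmodule g (coinduced_unit a) = coinduced_unit (M g a).
Proof.
apply/ffunP => i; rewrite !ffunE -gactM.
by apply: (acts_trivially_cong _ tN); apply: cong_sigma.
Qed.

Lemma coinduced_unit_coboundary1 b g h :
  coboundary1 coinduced_gmodule (fun x => coinduced_unit (b x)) g h =
  coinduced_unit (coboundary1 M b g h).
Proof.
by rewrite /coboundary1 coinduced_unit_act !coinduced_unitD coinduced_unitN.
Qed.

Lemma coinduced_unit_coboundary2 f g h l :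
  coboundary2 coinduced_gmodule (fun x y => coinduced_unit (f x y)) g h l =
  coinduced_unit (coboundary2 M f g h l).
Proof.
by rewrite /coboundary2 coinduced_unit_act !coinduced_unitD !coinduced_unitN.
Qed.

End Coinduction.

(* Dimension shifting: z becomes the coboundary of an inflated cochain w in the
   coinduced module, so that w - f is a 2-cocycle there. *)
Lemma inflate_primitive3 (G : groupType) (A : finZmodType) (M : gmodule G A)
    (N : finite_index_normal G) (z : G -> G -> G -> A) (f : G -> G -> A) :
  abelian_extensions_rf G -> acts_trivially M N -> inflated3 N z ->
  (forall g h l, z g h l = coboundary2 M f g h l) ->
  exists (K : finite_index_normal G) (f' : G -> G -> A),
    inflated2 K f' /\ forall g h l, z g h l = coboundary2 M f' g h l.
Proof.
move=> rfG tN iz zf.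
have [m [kappa [sigma [kappaK kappaP]]]] := finite_index_classify N.
have sN := finite_index_subgroup N.
pose M' : gmodule G (coinduced A m) := coinduced_gmodule A kappaK kappaP.
pose eta := coinduced_unit M sigma.
(* The contracting homotopy of the coinduced module: the first argument of [z] becomes the variable
   of the function, and the cocycle identity yields [wE]. *)
pose w g h : coinduced A m := [ffun i => z (sigma i) g h].
have wE g h l : coboundary2 M' w g h l = eta (z g h l).
  apply/ffunP => i; rewrite !ffunE -(coboundary2_cocycle _ _ _ _ zf).
  congr (_ - _ + _ - _)%R; apply: iz; try exact: cong_refl.
  exact: cong_sigma kappaK kappaP _.
have cw g h l : coboundary2 M' (fun x y => w x y - eta (f x y))%R g h l = 0%R.
  rewrite coboundary2B wE zf coinduced_unit_coboundary2 //; exact: subrr.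
have [N2 [u iu]] := inflate_cocycle2 rfG cw.
have [L LE] := finite_index_setI N N2.
pose c g h : coinduced A m := (w g h - eta (f g h) - coboundary1 M' u g h)%R.
have iwc : inflated2 L (fun g h => w g h - c g h)%R.
  rewrite LE => g g' h h' [Ng N2g] [Nh N2h]; congr (_ - _)%R.
    by apply/ffunP => i; rewrite !ffunE; apply: iz => //; apply: cong_refl.
  exact: iu.
have tM' : acts_trivially M' N by apply: coinduced_acts_trivially.
have tL : acts_trivially M' L by rewrite LE => g a [/tM'].
have etaB a b : eta (a - b)%R = (eta a - eta b)%R.
  by rewrite /eta coinduced_unitD coinduced_unitN.
have wcE g h : (w g h - c g h = eta (f g h) + coboundary1 M' u g h)%R.
  rewrite /c; zmod.
(* Modulo the image of [eta], the inflated cochain [w - c] is the coboundary of [u]; so [u] is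
   inflated up to values [eta b], and [b] is the correction to [f]. *)
have [||||K [u' [iu' uu']]] := inflate_primitive (B := range eta) (k := u) _ _ _ tL iwc.
- by exists 0%R => //; apply: coinduced_unit0.
- by move=> _ _ [a _ <-] [b _ <-]; exists (a - b)%R.
- by move=> g _ [a _ <-]; exists (M g a); rewrite // /eta -coinduced_unit_act.
- by move=> g h; exists (f g h) => //; rewrite wcE addrK.
have /choice[b bE] : forall g, exists b, eta b = (u g - u' g)%R.
  by move=> g; have [b _ bE] := uu' g; exists b.
have [P PE] := finite_index_setI L K.
exists P, (fun g h => f g h + coboundary1 M b g h)%R; split=> [|g h l]; last first.
  by rewrite coboundary2D coboundary21 addr0.
have etaE g h : eta (f g h + coboundary1 M b g h)%R =
    (w g h - c g h - coboundary1 M' u' g h)%R.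
  rewrite wcE /eta coinduced_unitD -coinduced_unit_coboundary1 //.
  have -> : (fun x => coinduced_unit M sigma (b x)) = (fun x => u x - u' x)%R.
    by apply/funext => x; apply: bE.
  by rewrite coboundary1B addrA.
rewrite PE => g g' h h' [Lg Kg] [Lh Kh].
apply: (@coinduced_unit_inj _ _ M _ kappa sigma); rewrite -/eta !etaE.
congr (_ - _)%R; first exact: iwc.
exact: (inflated_coboundary1 tL iu').
Qed.

(** * The topology of the profinite completion *)

Lemma cvg_initial (S : choiceType) (T : topologicalType) (f : S -> T)
    (F : set_system S) (x : S) : Filter F ->
  (forall B, nbhs (f x) B -> F (f @^-1` B)) -> F --> (x : initial_topology f).
Proof.
move=> FF FB A /= [_ [[B Bop <-] Bfx sBA]]; apply: filterS sBA _.
by apply: FB; apply: open_nbhs_nbhs.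
Qed.

Section Levels.
Variables (G : groupType) (n : nat).
Local Notation Ghat := (profinite_completion G).

Definition level (N : finite_index_normal G) (y : Ghat) : quotient_group N := val y N.

Definition same_level (N : finite_index_normal G) (x y : 'I_n -> Ghat) : Prop :=
  forall i, level N (x i) = level N (y i).

Lemma level_sub (N K : finite_index_normal G) (x y : Ghat) :
  N `<=` K -> level N x = level N y -> level K x = level K y.
Proof.
move=> NK; have [cx cy] := (set_mem (valP x), set_mem (valP y)).
rewrite /level => xy; pose g := repr (val x N : quotient_group N).
have xg : val x N = \pi_(quotient_group N) g by rewrite reprK.
rewrite (cx N K NK g xg); symmetry; apply: (cy N K NK); by rewrite -xy.
Qed.

(** One subgroup controls all coordinates at once, because finite-index normal subgroups are closed
    under intersection. *)
Lemma same_level_filter (x : 'I_n -> Ghat) :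
  Filter (filter_from [set: finite_index_normal G] (fun N => same_level N x)).
Proof.
apply: filter_from_filter.
  by have [N _] := finite_index_setT G; exists N.
move=> N K _ _; have [L LE] := finite_index_setI N K; exists L => // y xy.
split=> i; apply: level_sub (xy i); rewrite LE; [exact: subIsetl|exact: subIsetr].
Qed.

Lemma same_level_cvg (x : {ptws 'I_n -> Ghat}) :
  filter_from [set: finite_index_normal G] (fun N => same_level N x) --> x.
Proof.
have FF := same_level_filter x.
apply/cvg_sup => i; apply: cvg_initial => B.
suff: (fun y : {ptws 'I_n -> Ghat} => y i) @
    filter_from [set: finite_index_normal G] (fun N => same_level N x) --> x i.
  by apply.
apply: cvg_initial => {}B.
suff: (fun y : {ptws 'I_n -> Ghat} => set_val (y i)) @
    filter_from [set: finite_index_normal G] (fun N => same_level N x)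
    --> (set_val (x i) : finite_quotient_prod G).
  by apply.
apply/cvg_sup => N; apply: cvg_initial => {}B /principal_filterP Bx.
by exists N => // y xy; exact: (eq_ind _ B Bx _ (xy i)).
Qed.

Lemma nbhs_same_level (N : finite_index_normal G) (x : {ptws 'I_n -> Ghat}) :
  nbhs x [set y | same_level N x y].
Proof.
apply: (@filter_forall _ _ (fun i => [set y : {ptws 'I_n -> Ghat} | level N (x i) = level N (y i)])
  (nbhs x) (nbhs_filter x)) => i.
have cont : continuous (fun y : {ptws 'I_n -> Ghat} =>
    (val (y i) N : discrete_topology (quotient_group N))).
  move=> y; apply: (@continuous_comp _ _ _ (fun y : {ptws 'I_n -> Ghat} => y i)
    (fun z : Ghat => (val z N : discrete_topology (quotient_group N)))).
    exact: proj_continuous.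
  apply: (@continuous_comp _ _ _ (val : Ghat -> finite_quotient_prod G)
    (fun z => (z N : discrete_topology (quotient_group N)))).
    exact: initial_continuous.
  exact: proj_continuous.
apply: (@filterS _ _ (nbhs_filter x) _ _ _ (cont x _ (discrete_set1 _))) => y.
by move=> /= yx; apply: esym.
Qed.

(** Compactness of the powers of the completion, from Tychonoff on the product of all finite
    quotients. A cluster point there is compatible because each compatibility condition involves
    only two coordinates. *)
Lemma same_level_cluster (F : set_system ('I_n -> Ghat)) : ProperFilter F ->
  exists x : 'I_n -> Ghat, forall N B, F B -> exists2 y, B y & same_level N x y.
Proof.
move=> PF; pose I : eqType := ('I_n * finite_index_normal G)%type.
pose T (p : I) : topologicalType := discrete_topology (quotient_group p.2).
pose Phi (x : 'I_n -> Ghat) : prod_topology T := fun p => level p.2 (x p.1).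
have cT : compact [set f : prod_topology T | forall p, [set: T p] (f p)].
  by apply: (@tychonoff I T (fun=> setT)) => p; apply: finite_compact; apply: (finite_indexP p.2).
have [|y [_ cy]] := cT (Phi @ F) (fmap_proper_filter Phi PF).
  by apply: (@filterS _ F _ setT); [move=> x _ p|apply: filterT].
have coord (p : I) : nbhs (y : prod_topology T) [set z | z p = y p].
  exact: (@proj_continuous _ _ p y _ (@discrete_set1 (T p) (y p))).
pose w (i : 'I_n) : finite_quotient_prod G := fun N : finite_index_normal G => y (i, N).
have cy_compatible i : compatible (w i).
  move=> N K NK g yN.
  have [_ [[x _ <-] [xN xK]]] : range Phi `&`
      ([set z | z (i, N) = y (i, N)] `&` [set z | z (i, K) = y (i, K)]) !=set0.
    apply: cy; first by apply: (@filterS _ F _ setT); [move=> x _; exists x|apply: filterT].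
    by apply: (@filterI _ _ (nbhs_filter (y : prod_topology T))).
  rewrite /w -xK; apply: (set_mem (valP (x i))) NK _ _.
  by rewrite -yN; exact: xN.
pose z (i : 'I_n) : Ghat :=
  exist _ (w i) (mem_set (cy_compatible i)).
exists z => N B FB.
have [_ [[x Bx <-] yx]] : (Phi @` B) `&`
    [set z : prod_topology T | forall i : 'I_n, z (i, N) = y (i, N)] !=set0.
  apply: cy; first by apply: (@filterS _ F _ B) FB => x Bx; exists x.
  apply: (@filter_forall _ _ (fun i => [set z : prod_topology T | z (i, N) = y (i, N)])
    (nbhs (y : prod_topology T)) (nbhs_filter _)) => i.
  exact: coord.
by exists x => // i; apply: esym; exact: (yx i).
Qed.

End Levels.

(** * The comparison map *)

Definition inflated (G : groupType) (A : zmodType) n (N : set G)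
    (f : cochain G A n) : Prop :=
  forall v w, (forall i, cong N (v i) (w i)) -> f v = f w.

Section LowDegree.
Variables (G : groupType) (A : finZmodType) (M : gmodule G A).

Definition cochain1 (k : G -> A) : cochain G A 1 := fun v => k (v ord0).
Definition cochain2 (f : G -> G -> A) : cochain G A 2 :=
  fun v => f (v ord0) (v (lift ord0 ord0)).
Definition cochain3 (z : G -> G -> G -> A) : cochain G A 3 :=
  fun v => z (v ord0) (v (lift ord0 ord0)) (v (lift ord0 (lift ord0 ord0))).

Lemma cochain1_ex (f : cochain G A 1) : exists k, f = cochain1 k.
Proof.
exists (fun g => f (fun=> g)); apply/funext => v; congr f; apply/funext => i.
by rewrite ord1.
Qed.

Lemma cochain2_ex (f : cochain G A 2) : exists k, f = cochain2 k.
Proof.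
exists (fun g h => f (fun i => nth g [:: g; h] i)); apply/funext => v.
congr f; apply/funext => -[[|[|i]] lti] //=; congr v; exact: val_inj.
Qed.

Lemma cochain3_ex (f : cochain G A 3) : exists k, f = cochain3 k.
Proof.
exists (fun g h l => f (fun i => nth g [:: g; h; l] i)); apply/funext => v.
congr f; apply/funext => -[[|[|[|i]]] lti] //=; congr v; exact: val_inj.
Qed.

Let widen_ord0 n : widen_ord (leqnSn n.+1) ord0 = ord0.
Proof. exact: val_inj. Qed.

Let widen_lift n (i : 'I_n) :
  widen_ord (leqnSn n.+1) (lift ord0 i) = lift ord0 (widen_ord (leqnSn n) i).
Proof. exact: val_inj. Qed.

Lemma differential_cochain1 k :
  differential M (cochain1 k) = cochain2 (coboundary1 M k).
Proof.
apply/funext => v; rewrite /differential big_ord_recl big_ord0 addr0.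
rewrite /cochain1 /cochain2 /coboundary1 /merge_at /= !widen_ord0.
by rewrite -!(signr_odd _ _.+1) /= expr0 expr1 mulr1z mulrN1z.
Qed.

Lemma differential_cochain2 f :
  differential M (cochain2 f) = cochain3 (coboundary2 M f).
Proof.
apply/funext => v; rewrite /differential !big_ord_recl big_ord0 addr0.
rewrite /cochain2 /cochain3 /coboundary2 /merge_at /= !widen_lift !widen_ord0.
by rewrite -!(signr_odd _ _.+1) /= expr0 expr1 mulr1z !mulrN1z !addrA.
Qed.

Lemma cochain2_inj f k : cochain2 f = cochain2 k -> forall g h, f g h = k g h.
Proof.
by move=> fk g h; have /(congr1 (@^~ (fun i : 'I_2 => nth g [:: g; h] i))) := fk.
Qed.

Lemma cochain3_inj f k : cochain3 f = cochain3 k -> forall g h l, f g h l = k g h l.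
Proof.
by move=> fk g h l; have /(congr1 (@^~ (fun i : 'I_3 => nth g [:: g; h; l] i))) := fk.
Qed.

Lemma cochain3_eq0 z : cochain3 z = 0%R -> forall g h l, z g h l = 0%R.
Proof. exact: (@cochain3_inj z (fun _ _ _ => 0%R)). Qed.

Lemma cochain2_eq0 z : cochain2 z = 0%R -> forall g h, z g h = 0%R.
Proof. exact: (@cochain2_inj z (fun _ _ => 0%R)). Qed.

Lemma inflated_cochain1 (N : set G) k : inflated1 N k -> inflated N (cochain1 k).
Proof. by move=> ik v w vw; apply: ik. Qed.

Lemma inflated_cochain2 (N : set G) k : inflated2 N k <-> inflated N (cochain2 k).
Proof.
split=> [ik v w vw|ik g g' h h' gg' hh']; first exact: ik.
apply: (ik (fun i => nth g [:: g; h] i) (fun i => nth g' [:: g'; h'] i)).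
by move=> [[|[|i]] lti].
Qed.

Lemma inflated_cochain3 (N : set G) k : inflated N (cochain3 k) -> inflated3 N k.
Proof.
move=> ik g g' h h' l l' gg' hh' ll'.
apply: (ik (fun i => nth g [:: g; h; l] i) (fun i => nth g' [:: g'; h'; l'] i)).
by move=> [[|[|[|i]]] lti].
Qed.

End LowDegree.

Section UniformCochains.
Variables (G : groupType) (A : zmodType).
Local Notation Ghat := (profinite_completion G).

(** Uniform continuity. Otherwise the points violating the conclusion at each level form a proper
    filter, whose cluster point contradicts local constancy of [f]. *)
Lemma continuous_same_level n (f : cochain Ghat A n) : continuous_cochain f ->
  exists N, forall x y, same_level N x y -> f x = f y.
Proof.
move=> /continuous_cochainP cf; apply: contrapT => nN.
pose B (N : finite_index_normal G) : set ('I_n -> Ghat) :=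
  [set y | exists2 y', same_level N y y' & f y <> f y'].
have PF : ProperFilter (filter_from [set: finite_index_normal G] B).
  apply: filter_from_proper; last first.
    move=> N _; apply: contrapT => BN; apply: nN; exists N => x y xy.
    by apply: contrapT => fxy; apply: BN; exists x; exists y.
  apply: filter_from_filter; first by have [N _] := finite_index_setT G; exists N.
  move=> N K _ _; have [L LE] := finite_index_setI N K.
  exists L => // y [y' yy' fyy'].
  split; exists y' => // i; apply: level_sub (yy' i); rewrite LE.
    exact: subIsetl.
  exact: subIsetr.
have [x xP] := same_level_cluster PF.
have [N _ NP] := same_level_cvg (cf x).
have [y [y' yy' fyy'] xy] : exists2 y, B N y & same_level N x y.
  by apply: xP; exists N.
by apply: fyy'; rewrite (NP y xy) (NP y') // => i; rewrite (xy i) (yy' i).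
Qed.

Lemma same_level_continuous n (N : finite_index_normal G) (f : cochain Ghat A n) :
  (forall x y, same_level N x y -> f x = f y) -> continuous_cochain f.
Proof.
move=> fN; apply/continuous_cochainP => x.
apply: (@filterS _ _ (nbhs_filter x) _ _ _ (nbhs_same_level N x)) => y xy.
by apply/esym/fN.
Qed.

Lemma level_completion_map (N : finite_index_normal G) (x : Ghat) :
  level N x = level N (completion_map (repr (level N x))).
Proof. by rewrite {2}/level /= /completion_fun reprK. Qed.

Lemma level_completion_mapP (N : finite_index_normal G) (g h : G) :
  level N (completion_map g) = level N (completion_map h) <-> cong N g h.
Proof. exact: coset_piP. Qed.

Lemma levelM (N : finite_index_normal G) (x y : Ghat) :
  level N (x * y) = level N x * level N y.
Proof. by []. Qed.

(** Density of [G]: at level [N] every point agrees with a tuple of elements of [G]. *)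
Lemma pullback_eq0 n (N : finite_index_normal G) (f : cochain Ghat A n) :
  (forall x y, same_level N x y -> f x = f y) -> pullback f = 0%R -> f = 0%R.
Proof.
move=> fN f0; apply/funext => x.
rewrite (fN x (fun i => completion_map (repr (level N (x i))))).
  by have /(congr1 (@^~ (fun i => repr (level N (x i))))) := f0.
by move=> i; apply: level_completion_map.
Qed.

Definition hat_cochain n (N : finite_index_normal G) (f : cochain G A n) :
    cochain Ghat A n :=
  fun x => f (fun i => repr (level N (x i))).

Lemma hat_cochain_level n (N : finite_index_normal G) (f : cochain G A n) x y :
  same_level N x y -> hat_cochain N f x = hat_cochain N f y.
Proof. by move=> xy; congr f; apply/funext => i; rewrite xy. Qed.

Lemma pullback_hat_cochain n (N : finite_index_normal G) (f : cochain G A n) :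
  inflated N f -> pullback (hat_cochain N f) = f.
Proof.
move=> iN; apply/funext => v; apply: iN => i.
by apply/level_completion_mapP; rewrite -level_completion_map.
Qed.

Lemma inflated_pullback n (N : finite_index_normal G) (f : cochain Ghat A n) :
  (forall x y, same_level N x y -> f x = f y) -> inflated N (pullback f).
Proof.
by move=> fN v w vw; apply: fN => i; apply/level_completion_mapP.
Qed.

End UniformCochains.

Section Comparison.
Variables (G : groupType) (A : finZmodType) (M : gmodule (profinite_completion G) A).
Hypothesis cM : continuous_action M.
Local Notation Ghat := (profinite_completion G).
Local Notation C := (completion_gmodule M).

(** Each orbit map is constant at some level, and [A] is finite, so one level serves all
    elements. *)
Lemma continuous_action_level : exists N : finite_index_normal G,
  forall x y a, level N x = level N y -> M x a = M y a.
Proof.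
have /choice[P PP] : forall a, exists N : finite_index_normal G,
    forall x y, level N x = level N y -> M x a = M y a.
  move=> a; pose f : cochain Ghat A 1 := fun v => M (v ord0) a.
  have [|N NP] := @continuous_same_level G A 1 f.
    move=> v; apply: (@continuous_comp _ _ _
      (fun v : {ptws 'I_1 -> Ghat} => (v ord0, a : discrete_topology A))
      (fun p => M p.1 p.2 : discrete_topology A)); last exact: cM.
    have proj0 : (w ord0 @[w --> v] --> v ord0)%classic.
      exact: (@proj_continuous _ (fun _ : 'I_1 => Ghat) ord0 v).
    have csta : (a @[w --> v] --> (a : discrete_topology A))%classic.
      exact: (@cst_continuous _ (discrete_topology A) a v).
    move=> B; apply: (@cvg_pair _ _ _ _ _ _ (nbhs_filter v)
      (nbhs_filter (v ord0)) (nbhs_filter (a : discrete_topology A)) _ _ proj0 csta B).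
  exists N => x y xy.
  by apply: (NP (fun=> x) (fun=> y)).
have [L LP] := finite_index_bigcap P.
by exists L => x y a xy; apply: PP; apply: level_sub xy; apply: LP.
Qed.

Lemma differential_same_level n (N : finite_index_normal G) (f : cochain Ghat A n) :
  (forall x y, same_level N x y -> f x = f y) ->
  exists K, forall x y, same_level K x y -> differential M f x = differential M f y.
Proof.
move=> fN; have [P PP] := continuous_action_level.
have [K KE] := finite_index_setI N P; exists K => x y xy.
have xyN i : level N (x i) = level N (y i).
  by apply: level_sub (xy i); rewrite KE; apply: subIsetl.
have xyP : level P (x ord0) = level P (y ord0).
  by apply: level_sub (xy ord0); rewrite KE; apply: subIsetr.
rewrite /differential (PP _ _ _ xyP); congr (_ + _ + _ *~ _)%R.
- by congr (M _ _); apply: fN => i; apply: xyN.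
- apply: eq_bigr => i _; congr (_ *~ _)%R; apply: fN => j.
  by rewrite /merge_at; case: ifP => // _; case: ifP => // _; rewrite !levelM !xyN.
- by apply: fN => i; apply: xyN.
Qed.

Lemma completion_acts_trivially : exists N : finite_index_normal G, acts_trivially C N.
Proof.
have [N NP] := continuous_action_level; exists N => g a Ng.
rewrite -[RHS](gact1 M); apply: NP; rewrite -completion_map1.
apply/level_completion_mapP; rewrite /cong mulg1.
by have [_ _ NV] := finite_index_subgroup N; apply: NV.
Qed.

(** The difference of two continuous cocycles is inflated from a finite level. An inflated primitive
    of it lifts to the completion, where density of [G] transfers the equation. *)
Lemma comparison_injective n :
  (forall (N : finite_index_normal G) (z : cochain G A n.+1) (h : cochain G A n),
     inflated N z -> z = differential C h ->
     exists (K : finite_index_normal G) (k : cochain G A n),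
       inflated K k /\ z = differential C k) ->
  injective (@comparison_map G A M n.+1).
Proof.
move=> inj x y; rewrite -[x]reprK -[y]reprK.
move: (repr x) (repr y) => {}x {}y.
rewrite -!/(cohomology_class _) !comparison_mapE => /cohomology_class_eq.
rewrite -pullbackB => -[h _ hE]; apply/cohomology_class_eq.
set z := (_ - _)%R in hE *.
have [N NP] : exists N, forall x y, same_level N x y -> z x = z y.
  apply: continuous_same_level; apply: (continuous_cochain_subproof _ _ _).2.
    by have /asboolP[] := valP x.
  by have /asboolP[] := valP y.
have [K [k [iK kE]]] := inj N _ h (inflated_pullback NP) (esym hE).
exists (hat_cochain K k).
  exact: same_level_continuous (@hat_cochain_level _ _ _ K k).
have [P PP] := differential_same_level (@hat_cochain_level _ _ _ K k).
have [L LE] := finite_index_setI N P.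
apply: subr0_eq; apply: (@pullback_eq0 _ _ _ L).
  move=> u v uv; congr (_ - _)%R.
    by apply: PP => i; apply: level_sub (uv i); rewrite LE; apply: subIsetr.
  by apply: NP => i; apply: level_sub (uv i); rewrite LE; apply: subIsetl.
by rewrite pullbackB pullback_differential pullback_hat_cochain // kE subrr.
Qed.

Lemma comparison_injective0 : injective (@comparison_map G A M 0).
Proof.
move=> x y; rewrite -[x]reprK -[y]reprK.
move: (repr x) (repr y) => {}x {}y.
rewrite -!/(cohomology_class _) !comparison_mapE => /cohomology_class_eq.
rewrite /coboundary_set -pullbackB => xy; apply/cohomology_class_eq.
have [N _] := finite_index_setT G.
apply: (@pullback_eq0 _ _ _ N) => // u v _; congr (_ - _)%R; congr (val _ _).
  by apply/funext => -[].
by apply/funext => -[].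
Qed.

Lemma comparison_surjective n :
  (forall f : cochain G A n, differential C f = 0%R ->
     exists (N : finite_index_normal G) (k : cochain G A n),
       [/\ inflated N k, differential C k = 0%R &
           coboundary_set C (all_cochains G A) (k - f)%R]) ->
  forall y, exists x, @comparison_map G A M n x = y.
Proof.
move=> surj y; rewrite -[y]reprK; move: (repr y) => {}y.
have /asboolP[_ dy] := valP y.
have [N [k [iN dk kf]]] := surj _ dy.
have hat_cocycle : hat_cochain N k \in cocycle_pred M (continuous_cochains G A) n.
  apply/asboolP; split; first exact: same_level_continuous (@hat_cochain_level _ _ _ N k).
  have [P PP] := differential_same_level (@hat_cochain_level _ _ _ N k).
  apply: (pullback_eq0 PP).
  by rewrite pullback_differential pullback_hat_cochain.
pose z : cocycle M (continuous_cochains G A) n :=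
  exist _ (hat_cochain N k) hat_cocycle.
exists (cohomology_class z).
rewrite comparison_mapE; apply/cohomology_class_eq => /=.
by rewrite pullback_hat_cochain.
Qed.

End Comparison.

Lemma bijective_of_inj_surj (S T : Type) (f : S -> T) :
  injective f -> (forall y, exists x, f x = y) -> bijective f.
Proof.
move=> fI /choice[g gP]; exists g => // x; exact: fI.
Qed.

Lemma class_A2_of_extensions (G : groupType) : abelian_extensions_rf G -> class_A 2 G.
Proof.
move=> rfG A M cM; have [N0 tN0] := completion_acts_trivially cM.
set C := completion_gmodule M in tN0.
(* With the zero subgroup as [B], a 1-cochain with inflated coboundary is itself inflated; this
   serves injectivity in degree 2 and surjectivity in degree 1. *)
have inflate1 (N : finite_index_normal G) (w : G -> G -> A) (k : G -> A) :
    inflated2 N w -> (forall g h, w g h = coboundary1 C k g h) ->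
    exists K : finite_index_normal G, inflated1 K k.
  move=> iw wk; have [K KE] := finite_index_setI N0 N.
  have tK : acts_trivially C K by rewrite KE => g a [/tN0].
  have iwK : inflated2 K w.
    by rewrite KE => g g' h h' [_ gg'] [_ hh']; apply: iw.
  have [||||L [k' [ik' kk']]] :=
    @inflate_primitive _ _ C [set 0%R] K w k _ _ _ tK iwK.
  - by [].
  - by move=> a b -> ->; rewrite /= subrr.
  - by move=> g a ->; apply: gact0.
  - by move=> g h; rewrite /= wk subrr.
  by exists L => g g' /ik' gg'; rewrite (subr0_eq (kk' g)) (subr0_eq (kk' g')).
have inj0 : injective (@comparison_map G A M 0) by apply: comparison_injective0.
have inj1 : injective (@comparison_map G A M 1).
  (* A 0-cochain has only one argument tuple, so it is inflated from any level. *)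
  apply: comparison_injective => // N z h _ ->; exists N, h; split=> // v w _.
  by congr h; apply/funext => -[].
have inj2 : injective (@comparison_map G A M 2).
  apply: comparison_injective => // N z h; have [w ->] := cochain2_ex z.
  have [k ->] := cochain1_ex h; rewrite differential_cochain1.
  move=> /inflated_cochain2 iw /cochain2_inj wk; have [K iK] := inflate1 N w k iw wk.
  exists K, (cochain1 k); split; first exact: inflated_cochain1.
  by rewrite differential_cochain1; congr cochain2; apply/funext => g; apply/funext => l.
have inj3 : injective (@comparison_map G A M 3).
  apply: comparison_injective => // N z h; have [w ->] := cochain3_ex z.
  have [f ->] := cochain2_ex h; rewrite differential_cochain2.
  move=> /inflated_cochain3 iw /cochain3_inj wf; have [K KE] := finite_index_setI N0 N.
  have tK : acts_trivially C K by rewrite KE => g a [/tN0].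
  have iwK : inflated3 K w.
    by rewrite KE => g g' l l' p p' [_ ?] [_ ?] [_ ?]; apply: iw.
  have [L [f' [if' wf']]] := inflate_primitive3 rfG tK iwK wf.
  exists L, (cochain2 f'); split; first exact/inflated_cochain2.
  rewrite differential_cochain2; congr cochain3.
  by apply/funext => g; apply/funext => l; apply/funext => p.
have surj0 : forall y, exists x, @comparison_map G A M 0 x = y.
  apply: comparison_surjective => // f df; exists N0, f; split=> //.
    by move=> v w _; congr f; apply/funext => -[].
  by rewrite /coboundary_set /= subrr.
have surj1 : forall y, exists x, @comparison_map G A M 1 x = y.
  apply: comparison_surjective => // f; have [k ->] := cochain1_ex f.
  rewrite differential_cochain1 => dk.
  have [K iK] := inflate1 N0 (fun _ _ => 0%R) k (fun _ _ _ _ _ _ => erefl)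
    (fun g h => esym (cochain2_eq0 dk g h)).
  exists K, (cochain1 k); split; first exact: inflated_cochain1.
    by rewrite differential_cochain1.
  by exists 0%R => //; rewrite subrr differential0.
have surj2 : forall y, exists x, @comparison_map G A M 2 x = y.
  apply: comparison_surjective => // f; have [k ->] := cochain2_ex f.
  rewrite differential_cochain2 => /cochain3_eq0 dk.
  have [K [u iu]] := inflate_cocycle2 rfG dk.
  exists K, (cochain2 k - cochain2 (coboundary1 C u))%R; split.
  - exact: (iffLR (@inflated_cochain2 G A K (fun g h => k g h - coboundary1 C u g h)%R) iu).
  - rewrite differentialB !differential_cochain2.
    apply/funext => v; rewrite -[LHS]/(_ - _)%R /cochain3 dk coboundary21 subrr.
    by [].
  - exists (- cochain1 u)%R => //.
    rewrite -[in LHS](sub0r (cochain1 u)) differentialB differential0.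
    by rewrite differential_cochain1 sub0r addrAC subrr sub0r.
split=> // -[|[|[|i]]] // _; exact: bijective_of_inj_surj.
Qed.

Theorem theorem4p12 (G : groupType) (phi : {multiplicative G -> G})
    (hG : polycyclic G) (hphi : injective phi) :
  highly_residually_finite (ascending_hnn phi).
Proof.
split; first exact: hnn_residually_finite.
apply: class_A2_of_extensions => E f fM f_surj fin_ker ab_ker.
exact: (hnn_extension_residually_finite hG fM f_surj fin_ker ab_ker).
Qed.
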